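(* Let $\mathcal{X}=(\mathcal{X}_e:e\in E_{2n})$ be distributions of edge weights of the complete graph $K_{2n}=(V_{2n},E_{2n})$ such that each $\mathcal{X}_e$ is supported on $[-1,1]$ and has its density function bounded from above by a parameter $\phi>0$, and let the edge weights $X=(X_e)_{e\in E_{2n}}$ be drawn independently with $X_e\sim\mathcal{X}_e$. Then with probability at least $1-o_n(1)$ over the draw of $X$, every implementation of the SWAP algorithm (i.e. for every initial balanced partition and every pivoting rule) running on $K_{2n}$ with edge weights $X$ terminates after at most $\phi\, n^{O(\log^{10} n)}$ steps.
   Context: Graph Partitioning: given edge weights $X_e\in[-1,1]$ on the complete graph $K_{2n}$, a balanced partition is a partition $(U,V)$ of the $2n$ nodes into two sets of size $n$; its cut weight is the sum of $X_e$ over edges $e$ with one endpoint in $U$ and the other in $V$. The SWAP algorithm starts from an arbitrary balanced partition and, as long as there exist $u\in U$, $v\in V$ such that exchanging $u$ and $v$ between the two parts strictly decreases the cut weight, performs one such swap (chosen according to an arbitrary pivoting rule); it stops when no such pair exists. A step is one swap. *)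

(* Defs.v *)
From mathcomp Require Import all_boot all_order all_algebra.
From mathcomp Require Import all_classical all_reals all_analysis.

Set Implicit Arguments.
Unset Strict Implicit.
Unset Printing Implicit Defensive.

Import Order.TTheory GRing.Theory Num.Theory.
Import numFieldNormedType.Exports.

Local Open Scope ring_scope.

(* Edges of K_{2n} are the 2-element subsets of the node set 'I_n.*2. *)
Definition edge (n : nat) := {e : {set 'I_n.*2} | #|e| == 2%N}.

Section Swap.
Variables (R : realType) (n : nat).

Definition node_partition := ({set 'I_n.*2} * {set 'I_n.*2})%type.

Definition balanced (p : node_partition) : bool :=
  [&& p.2 == ~: p.1, #|p.1| == n & #|p.2| == n].

Definition crossing (p : node_partition) (e : edge n) : bool :=
  (#|val e :&: p.1| == 1%N) && (#|val e :&: p.2| == 1%N).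

Definition cut_weight (w : edge n -> R) (p : node_partition) : R :=
  \sum_(e : edge n | crossing p e) w e.

Definition exchange (p : node_partition) (u v : 'I_n.*2) : node_partition :=
  (v |: (p.1 :\ u), u |: (p.2 :\ v)).

Definition improving (w : edge n -> R) (p : node_partition) (u v : 'I_n.*2)
    : bool :=
  [&& u \in p.1, v \in p.2 & cut_weight w (exchange p u v) < cut_weight w p].

(* A pivoting rule may depend on the whole history of the run (the earlier
   partitions, most recent first) besides the current partition; [None] means
   that the algorithm stops. *)
Definition pivoting_rule :=
  seq node_partition -> node_partition -> option ('I_n.*2 * 'I_n.*2).

(* The rule swaps as long as an improving pair exists, and stops only when
   there is none. *)
Definition implements_swap (w : edge n -> R) (rule : pivoting_rule) : Prop :=
  forall h p, balanced p ->
    match rule h p return Prop with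
    | Some (u, v) => improving w p u v
    | None => forall u v, ~~ improving w p u v
    end.

Definition swap_step (rule : pivoting_rule)
    (s : seq node_partition * node_partition) :=
  let: (h, p) := s in
  match rule h p with
  | Some (u, v) => (p :: h, exchange p u v)
  | None => s
  end.

Definition swap_run (rule : pivoting_rule) (p0 : node_partition) (k : nat) :=
  iter k (swap_step rule) ([::], p0).

(* A stopped run is stationary, so the least such [k] is the number of swaps
   performed. *)
Definition terminates_within (rule : pivoting_rule) (p0 : node_partition)
    (B : R) : Prop :=
  exists k : nat,
    k%:R <= B /\ rule (swap_run rule p0 k).1 (swap_run rule p0 k).2 = None.

Definition every_swap_terminates_within (w : edge n -> R) (B : R) : Prop :=
  forall (p0 : node_partition) (rule : pivoting_rule),
    balanced p0 -> implements_swap w rule -> terminates_within rule p0 B.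

End Swap.

Definition mutually_independent d (T : measurableType d) (R : realType)
    (P : probability T R) (I : finType) (X : I -> {RV P >-> R}) : Prop :=
  forall (J : {set I}) (B : I -> set R), (forall i, measurable (B i)) ->
    P (\bigcap_(i in [set` J]) (X i @^-1` B i))%classic
    = (\prod_(i in J) P (X i @^-1` B i)%classic)%E.

Definition supported_on_unit (R : realType) (mu : probability R R) : Prop :=
  mu `[(-1 : R), 1]%classic = 1%E.

Definition has_density_le (R : realType) (phi : R) (mu : probability R R)
    : Prop :=
  exists f : R -> R,
    [/\ measurable_fun [set: R]%classic f,
        forall x, 0 <= f x <= phi
      & forall A : set R, measurable A ->
          mu A = (\int[lebesgue_measure]_(x in A) (f x)%:E)%E].

(* Main.v *)
(* View a swap of u in U with v in V as an oriented edge u -> v. In a weighted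
   sum of the improvements of a window of steps, the edges between moved and
   unmoved nodes cancel as soon as the weights form a circulation of the
   multigraph of swaps; the sum then is an integer linear form in the edge
   weights that depends on the sequence of swaps only, not on the sides of the
   unmoved nodes. If l steps carry at least l / O(log^2 n) such forms in
   triangular position, the probability that all steps improve by at most
   eps / phi is eps^(l / O(log^2 n)), which beats the n^O(l) sequences of swaps
   for eps = n^(-O(log^2 n)).

   The forms come from nodes x that move often. Since configurations never
   repeat, among three moves of x there are two between which some node y,
   different from x and its two partners, changes sides. Subtracting these two
   moves leaves a flow from one partner to the other with a nonzero coefficient
   at {x, y}; each such flow is an edge on the set of partners, and each cycle
   of these edges is a circulation. If all nodes of a subgraph move a large
   constant number of times, each of them contributes many edges, hence there
   are at least as many independent cycles as nodes. A window with such a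
   subgraph on l / O(log^2 n) nodes is found by comparing dyadic scales: a swap
   is heavy if both its nodes move O(log n) times in the window; at scale 1 no
   swap is heavy, at scale n log n most are, and a swap that becomes heavy at
   some scale has a node that was still light one scale below. *)

Require Import Defs.
From mathcomp Require Import all_boot all_order all_algebra.
From mathcomp Require Import zify ring lra.

Set Implicit Arguments.
Unset Strict Implicit.
Unset Printing Implicit Defensive.

Import Order.TTheory GRing.Theory Num.Theory.

(** * Sequences of swaps *)

Section MoveSequence.
Variables (V : finType) (mv : nat -> V * V).
Implicit Types (U : nat -> {set V}) (x y z : V) (t l : nat).

Definition touches t x := (x == (mv t).1) || (x == (mv t).2).

Definition partner t x := if x == (mv t).1 then (mv t).2 else (mv t).1.

Definition flow t x : int :=
  if x == (mv t).1 then (-1)%R else if x == (mv t).2 then 1%R else 0%R.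

Definition swap_seq U l := forall t, t < l ->
  [/\ (mv t).1 \in U t, (mv t).2 \notin U t
    & U t.+1 = (mv t).2 |: (U t :\ (mv t).1)].

Definition side (A : {set V}) x : int := if x \in A then 1%R else (-1)%R.

(* The coefficient of the weight of the edge {x, y} in the improvement of step t. *)
Definition gain U t x y : int :=
  (((x \in U t) (+) (y \in U t))%:R - ((x \in U t.+1) (+) (y \in U t.+1))%:R)%R.

Section Swap.
Variables (U : nat -> {set V}) (l : nat).
Hypothesis HU : swap_seq U l.

Lemma swap_neq t : t < l -> (mv t).1 != (mv t).2.
Proof. by case/HU=> h1 h2 _; apply: contraNneq h2 => <-. Qed.

Lemma swap_neqE t : t < l ->
  (((mv t).1 == (mv t).2) = false) * (((mv t).2 == (mv t).1) = false).
Proof. by move/swap_neq/negbTE=> ne; split; rewrite // eq_sym. Qed.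

Lemma swap_flip t x : t < l -> (x \in U t.+1) = (x \in U t) (+) touches t x.
Proof.
move=> tl; have [h1 h2 ->] := HU tl; rewrite !inE /touches.
have [->|_] := eqVneq x (mv t).2; first by rewrite orbT addbT h2.
by have [->|_] := eqVneq x (mv t).1; rewrite ?h1 ?addbF.
Qed.

Lemma touches_side t x : t < l -> touches t x -> (x \in U t) = (x == (mv t).1).
Proof.
move=> tl; have [h1 h2 _] := HU tl.
by case/orP=> /eqP->; rewrite ?eqxx // (negbTE h2) (swap_neqE tl).
Qed.

Lemma touchesE t x y : t < l -> touches t x ->
  touches t y = (y == x) || (y == partner t x).
Proof.
move=> tl; rewrite /touches /partner.
by case/orP=> /eqP->; rewrite ?eqxx ?(swap_neqE tl) // orbC.
Qed.

Lemma partner_neq t x : t < l -> touches t x -> partner t x != x.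
Proof.
move=> tl; rewrite /touches /partner.
by case/orP=> /eqP->; rewrite ?eqxx ?(swap_neqE tl).
Qed.

Lemma partner_touches t x : t < l -> touches t x -> touches t (partner t x).
Proof. by move=> tl tx; rewrite (touchesE _ tl tx) eqxx orbT. Qed.

Lemma partner_side t x : t < l -> touches t x ->
  (partner t x \in U t) = (x \notin U t).
Proof.
move=> tl; have [h1 h2 _] := HU tl; rewrite /touches /partner.
by case/orP=> /eqP->; rewrite ?eqxx ?(swap_neqE tl) ?h1 ?(negbTE h2).
Qed.

Lemma swap_card t : t < l -> #|U t.+1| = #|U t|.
Proof.
move=> tl; have [h1 h2 ->] := HU tl.
by rewrite cardsU1 in_setD1 (negbTE h2) andbF /= [RHS](cardsD1 (mv t).1) h1.
Qed.

Lemma swap_card0 t : t <= l -> #|U t| = #|U 0|.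
Proof. by elim: t => // t IH tl; rewrite swap_card // IH // ltnW. Qed.

Lemma flow_out t x : ~~ touches t x -> flow t x = 0%R.
Proof. by rewrite /touches /flow; case: eqP => //= _ /negbTE->. Qed.

Lemma flow_partner t x : t < l -> touches t x ->
  flow t (partner t x) = (- flow t x)%R.
Proof.
move=> tl; rewrite /touches /flow /partner.
by case/orP=> /eqP->; rewrite ?eqxx ?(swap_neqE tl) ?eqxx ?opprK.
Qed.

Lemma flow_sqr t x : t < l -> touches t x -> (flow t x * flow t x = 1)%R.
Proof. by move=> tl; rewrite /touches /flow; case: eqP => //; case: eqP. Qed.

Lemma gain_out t x y : t < l -> ~~ touches t x -> ~~ touches t y -> gain U t x y = 0%R.
Proof.
move=> tl /negbTE tx /negbTE ty; rewrite /gain !swap_flip // tx ty !addbF; exact: subrr.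
Qed.

Lemma gain_touch t x y : t < l -> touches t x -> ~~ touches t y ->
  gain U t x y = (flow t x * side (U t) y)%R.
Proof.
move=> tl tx ty; rewrite /gain !swap_flip // tx (negbTE ty) addbF.
have := touches_side tl tx; move: tx; rewrite /flow /side /touches.
by case: eqP => /= [_ _ ->|_ /eqP-> ->]; rewrite ?eqxx; case: (y \in _).
Qed.

Lemma gainC t x y : gain U t x y = gain U t y x.
Proof. by rewrite /gain addbC [in X in (_ - X)%R]addbC. Qed.

Section Star.
Hypothesis Uinj : forall t t', t <= l -> t' <= l -> U t = U t' -> t = t'.
Variable x : V.

(* The one of the times t, t.+1 at which x is on side ~~ p and its partner on side p. *)
Definition bound_time p t := if (x \in U t) == p then t.+1 else t.

Lemma bound_time_x p t : t < l -> touches t x -> (x \in U (bound_time p t)) = ~~ p.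
Proof.
move=> tl tx; rewrite /bound_time; case: eqP => [<-|/eqP]; last by case: p; case: (_ \in _).
by rewrite swap_flip // tx addbT.
Qed.

Lemma bound_time_z p t : t < l -> touches t x -> (partner t x \in U (bound_time p t)) = p.
Proof.
move=> tl tx; rewrite /bound_time; case: eqP => [<-|/eqP].
  by rewrite swap_flip // partner_touches // partner_side // addbT negbK.
by rewrite partner_side //; case: p; case: (_ \in _).
Qed.

Lemma bound_time_out p t y : t < l -> touches t x -> y != x -> y != partner t x ->
  (y \in U (bound_time p t)) = (y \in U t).
Proof.
move=> tl tx y1 y2; rewrite /bound_time; case: eqP => // _.
by rewrite swap_flip // (touchesE _ tl tx) (negbTE y1) (negbTE y2) addbF.
Qed.

Definition agree a b := forall y,
  y != x -> y != partner a x -> y != partner b x -> (y \in U a) = (y \in U b).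

(** For either [p], the configurations at [bound_time p a] and [bound_time p b] coincide, hence so
    do these times; as [p] varies they run through [a], [a.+1] and through [b], [b.+1]. *)
Lemma agree_parallel a b : a < l -> b < l -> touches a x -> touches b x ->
  partner a x = partner b x -> agree a b -> a = b.
Proof.
move=> al bl ax bx ez ag.
have E p : bound_time p a = bound_time p b.
  have h t : t < l -> bound_time p t <= l by rewrite /bound_time => tl; case: ifP => // _; exact: ltnW.
  apply: Uinj; rewrite ?h //; apply/setP => y.
  case: (eqVneq y x) => [->|yx]; first by rewrite !bound_time_x.
  case: (eqVneq y (partner a x)) => [->|ya]; first by rewrite bound_time_z // ez bound_time_z.
  by rewrite !bound_time_out -?ez // ag // -ez.
have := E true; have := E false; rewrite /bound_time.
case: (x \in U a); case: (x \in U b) => /=; lia.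
Qed.

Lemma card_split3 (A : {set V}) y z : y != x -> z != x -> y != z ->
  #|A| = (x \in A) + ((y \in A) + ((z \in A) + \sum_(w | (w != x) && (w != y) && (w != z)) (w \in A))).
Proof.
move=> yx zx yz; rewrite -sum1_card big_mkcond /= (bigD1 x) //= (bigD1 y) //=.
rewrite (bigD1 z) /=; last by rewrite zx eq_sym.
by congr (_ + (_ + (_ + _))); do ?[by case: ifP]; apply: eq_bigr => i _; case: ifP.
Qed.

(** [U a] and [U b] have the same size. In each, [x] and its current partner contribute exactly one,
    and the nodes outside the three agree, so the third node contributes equally to both. *)
Lemma agree_cross a b : a < l -> b < l -> touches a x -> touches b x ->
  partner a x != partner b x -> agree a b ->
  (partner b x \in U a) = (partner a x \in U b).
Proof.
move=> al bl ax bx nz ag.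
have := swap_card0 (ltnW al); rewrite -(swap_card0 (ltnW bl)).
rewrite !(@card_split3 _ (partner a x) (partner b x)) ?partner_neq //.
rewrite partner_side // [in X in _ = X]partner_side //.
rewrite [in X in _ = X](eq_bigr (fun w => (w \in U a) : nat)); last first.
  by move=> w /andP[/andP[w1 w2] w3]; rewrite ag.
by case: (x \in U a); case: (x \in U b); case: (partner b x \in _); case: (partner a x \in _) => /=; lia.
Qed.

(** At both times [x] is on side [~~ p] and both partners are on side [p]; everything else agrees,
    and configurations do not repeat. *)
Lemma agree_bound_time p a b : a < l -> b < l -> touches a x -> touches b x ->
  partner a x != partner b x -> agree a b -> (partner b x \in U a) = p ->
  bound_time p a = bound_time p b.
Proof.
move=> al bl ax bx nz ag hp; have hp' := agree_cross al bl ax bx nz ag.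
have h t : t < l -> bound_time p t <= l by rewrite /bound_time => tl; case: ifP => // _; exact: ltnW.
apply: Uinj; rewrite ?h //; apply/setP => y.
case: (eqVneq y x) => [->|yx]; first by rewrite !bound_time_x.
case: (eqVneq y (partner a x)) => [->|ya].
  by rewrite bound_time_z // bound_time_out // ?partner_neq // -hp'.
case: (eqVneq y (partner b x)) => [->|yb].
  by rewrite bound_time_z // bound_time_out // ?partner_neq // eq_sym.
by rewrite !bound_time_out // ag.
Qed.

(* If no such y exists, then a single configuration occurs just before or just
   after each of the moves in I, which leaves room for two of them only. *)
Lemma star (I : {set 'I_l}) : 2 < #|I| -> (forall t : 'I_l, t \in I -> touches t x) ->
  exists a b : 'I_l, exists y, [/\ a \in I, b \in I
    & [&& y != x, y != partner a x, y != partner b x & (y \in U a) != (y \in U b)]].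
Proof.
move=> /card_gt2P[i1 [i2 [i3 [[I1 I2 I3] [n12 n23 n31]]]]] HI.
case: (boolP [exists a in I, [exists b in I, [exists y,
    [&& y != x, y != partner a x, y != partner b x & (y \in U a) != (y \in U b)]]]]).
  by case/exists_inP=> a aI /exists_inP[b bI /existsP[y hy]]; exists a, b, y.
move=> H; exfalso.
have ag (a b : 'I_l) : a \in I -> b \in I -> agree a b.
  move=> aI bI y y1 y2 y3; apply/eqP/negPn/negP => hy; case/negP: H.
  apply/exists_inP; exists a => //; apply/exists_inP; exists b => //.
  by apply/existsP; exists y; rewrite y1 y2 y3.
have nz (a b : 'I_l) : a \in I -> b \in I -> a != b -> partner a x != partner b x.
  move=> aI bI; apply: contraNneq => ez; apply/eqP/val_inj.
  by apply: agree_parallel ez _; rewrite ?HI ?ltn_ord //; exact: ag.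
have c (a b : 'I_l) : a \in I -> b \in I -> a != b -> (partner b x \in U a) = (partner a x \in U b).
  by move=> aI bI ab; apply: agree_cross; rewrite ?HI ?ltn_ord ?nz //; exact: ag.
have bt (a b : 'I_l) p : a \in I -> b \in I -> a != b -> (partner b x \in U a) = p ->
    bound_time p a = bound_time p b.
  by move=> aI bI ab; apply: agree_bound_time; rewrite ?HI ?ltn_ord ?nz //; exact: ag.
(* The same side [p] thus serves the pairs [i1], [i2] and [i1], [i3], so all three bound times
   coincide; but each is [t] or [t.+1] for one of three distinct [t]. *)
have e1 : (partner i3 x \in U i1) = (partner i2 x \in U i1).
  rewrite (ag i1 i2) // ?partner_neq ?HI // 1?nz // 1?eq_sym //.
  rewrite c // -(ag i1 i3) // ?partner_neq ?HI // 1?nz // 1?eq_sym //.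
have b12 := bt i1 i2 _ I1 I2 n12 (erefl _).
have b13 := bt i1 i3 _ I1 I3 _ e1; rewrite eq_sym in b13; have {}b13 := b13 n31.
have hb p t : (bound_time p t == t) || (bound_time p t == t.+1).
  by rewrite /bound_time; case: ifP; rewrite eqxx ?orbT.
have := hb (partner i2 x \in U i1) i1; have := hb (partner i2 x \in U i1) i2.
have := hb (partner i2 x \in U i1) i3; rewrite -b12 -b13.
move: n12 n23 n31; rewrite -!val_eqE /=; lia.
Qed.

End Star.
End Swap.
End MoveSequence.

(** * Nodes that move often *)

Section Chains.
Variables (V : finType) (mv : nat -> V * V) (U : nat -> {set V}) (l : nat).
Hypothesis HU : swap_seq mv U l.
Hypothesis Uinj : forall t t', t <= l -> t' <= l -> U t = U t' -> t = t'.

(** For a move [t] of [x] and [y != x], this is [flow mv t x * gain U t x y]: the orientation sign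
    is removed, and the partner gives 0 because both ends of the edge change sides. *)
Definition level x t y : int :=
  if y == partner mv t x then 0%R else side (U t) y.

(* A node x, two of its moves, and a node y that distinguishes them. *)
Definition switch : Type := V * 'I_l * 'I_l * V.
Definition node (e : switch) := e.1.1.1.
Definition time1 (e : switch) := e.1.1.2.
Definition time2 (e : switch) := e.1.2.
Definition witness (e : switch) := e.2.

Definition switching (e : switch) :=
  [&& touches mv (time1 e) (node e), touches mv (time2 e) (node e),
      witness e != node e, witness e != partner mv (time1 e) (node e),
      witness e != partner mv (time2 e) (node e)
    & level (node e) (time1 e) (witness e) != level (node e) (time2 e) (witness e)].

(** The triangular condition for switches of one node; switches of different nodes are separated
    later by the colouring. *)
Definition blind (e e' : switch) := (node e' != node e) ||
  (level (node e) (time1 e') (witness e) == level (node e) (time2 e') (witness e)).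

(* Each step continues in the largest of the three classes of moves of x on which
   the level of the last witness is constant. *)
Lemma chain x R (I : {set 'I_l}) :
  3 ^ R <= #|I| -> (forall t, t \in I -> touches mv t x) ->
  exists s : seq switch, [/\ size s = R,
    all (fun e => [&& switching e, node e == x, time1 e \in I & time2 e \in I]) s
    & pairwise blind s].
Proof.
elim: R I => [|R IH] I cI HI; first by exists [::].
have [|a [b [y [aI bI /and4P[yx ya yb yab]]]]] := star HU Uinj _ HI.
  by apply: leq_trans cI; rewrite expnS leq_pmulr // expn_gt0.
pose J (v : int) := [set t in I | level x t y == v].
have JI v t : t \in J v -> t \in I by rewrite inE => /andP[].
have [v cJ] : exists v, 3 ^ R <= #|J v|.
  suff : 3 ^ R.+1 <= #|J 0%R| + #|J 1%R| + #|J (-1)%R|.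
    have [h|h0] := leqP (3 ^ R) #|J 0%R|; first by exists 0%R.
    have [h|h1] := leqP (3 ^ R) #|J 1%R|; first by exists 1%R.
    have [h|h2] := leqP (3 ^ R) #|J (-1)%R|; first by exists (-1)%R.
    by rewrite expnS; lia.
  apply: leq_trans cI _; apply: (@leq_trans #|J 0%R :|: J 1%R :|: J (-1)%R|).
    apply/subset_leq_card/subsetP => t tI; rewrite !inE tI /= /level /side.
    by case: ifP => //; case: ifP.
  by do 2![rewrite -?addnA; apply: leq_trans (leq_card_setU _ _) _; rewrite ?addnA ?leq_add2r].
have [s [ss sa sp]] := IH _ cJ (fun t tJ => HI t (JI v t tJ)).
exists ((x, a, b, y) :: s); split => /=; rewrite ?ss //.
  rewrite /switching /node /time1 /time2 /witness /= !HI // yx ya yb aI bI eqxx /= !andbT.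
  rewrite /level (negbTE ya) (negbTE yb) /side; apply/andP; split.
    by move: yab; case: (y \in U a); case: (y \in U b).
  by apply: sub_all sa => e /and4P[? ? /JI ? /JI ?]; apply/and4P.
rewrite sp andbT; apply: sub_all sa => e /and4P[_ _].
by rewrite /blind !inE => /andP[_ /eqP e1] /andP[_ /eqP e2]; rewrite /node /witness /= e1 e2 eqxx orbT.
Qed.

Lemma chains R (M : {set 'I_l}) (s : seq V) : uniq s ->
  (forall x, x \in s -> 3 ^ R <= #|[set t in M | touches mv (t : 'I_l) x]|) ->
  exists es : seq switch, [/\ size es = R * size s,
    all (fun e => [&& switching e, node e \in s, time1 e \in M & time2 e \in M]) es
    & pairwise blind es].
Proof.
elim: s => [|x s IH] /=; first by exists [::]; rewrite muln0.
move=> /andP[xs us] Hs.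
have [es [ss sa sp]] := IH us (fun y ys => Hs y (mem_behead (s := x :: s) ys)).
have HM t : t \in [set t in M | touches mv (t : 'I_l) x] -> touches mv t x.
  by rewrite inE => /andP[].
have [es' [ss' sa' sp']] := chain (Hs x (mem_head _ _)) HM.
exists (es' ++ es); split.
- by rewrite size_cat ss ss' mulnS.
- rewrite all_cat; apply/andP; split.
    apply: sub_all sa' => e /and4P[? /eqP->]; rewrite !inE => /andP[? _] /andP[? _].
    by apply/and4P; rewrite eqxx.
  by apply: sub_all sa => e /and4P[? es1 ? ?]; apply/and4P; rewrite inE es1 orbT.
rewrite pairwise_cat sp sp' !andbT; apply/allrelP => e' e /(allP sa') /and4P[_ /eqP e1 _ _].
move=> /(allP sa) /and4P[_ e2 _ _]; rewrite /blind e1.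
by have -> : node e != x by apply: contraNneq xs => <-.
Qed.

(* In a random 3-colouring, a switch is kept with probability at least 1/81; the
   colours make the nodes, the partners and the witnesses of the kept switches
   disjoint. *)
Definition keep (f : {ffun V -> 'I_3}) (e : switch) :=
  [&& f (node e) == 0 :> nat, f (partner mv (time1 e) (node e)) == 1 :> nat,
      f (partner mv (time2 e) (node e)) == 1 :> nat & f (witness e) == 2 :> nat].

(** Recolouring the node, its two partners and the witness as required, while recording their four
    old colours, is injective on colourings. The partners may coincide, since both get colour 1. *)
Lemma card_keep e : switching e -> 3 ^ #|V| <= 81 * #|[set f | keep f e]|.
Proof.
case/and4P=> ax bx yx /and3P[ya yb _].
pose z1 := partner mv (time1 e) (node e); pose z2 := partner mv (time2 e) (node e).
have z1x : z1 != node e by apply: (partner_neq HU).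
have z2x : z2 != node e by apply: (partner_neq HU).
pose g (f : {ffun V -> 'I_3}) : {ffun V -> 'I_3} := [ffun v =>
  if v == node e then inord 0 else if v == witness e then inord 2 else
  if (v == z1) || (v == z2) then inord 1 else f v].
pose G f := (g f, (f (node e), f z1, f z2, f (witness e))).
have Ginj : injective G.
  move=> f f' [] /ffunP Eg E1 E2 E3 E4; apply/ffunP => v; have := Eg v; rewrite !ffunE.
  case: eqP => [->//|_]; case: eqP => [->//|_].
  by case: eqP => [->//|_]; case: eqP => [->//|_].
have -> : 3 ^ #|V| = #|[set: {ffun V -> 'I_3}]| by rewrite cardsT card_ffun card_ord.
rewrite -(card_imset [set: {ffun V -> 'I_3}] Ginj).
apply: (@leq_trans #|setX [set f | keep f e] [set: 'I_3 * 'I_3 * 'I_3 * 'I_3]|); last first.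
  by rewrite cardsX cardsT !card_prod card_ord mulnC.

apply/subset_leq_card/subsetP => _ /imsetP[f _ ->]; rewrite !inE /= andbT.
rewrite /keep !ffunE -/z1 -/z2 !eqxx orbT (negbTE yx) (negbTE z1x) (negbTE z2x).
by rewrite eq_sym in ya; rewrite eq_sym in yb; rewrite (negbTE ya) (negbTE yb) /= !inordK.
Qed.

(** First moment method: the number of kept switches is averaged over all colourings, and exchanging
    the sums leaves [card_keep] for each switch. *)
Lemma keep_many es : all switching es ->
  exists f, size es <= 81 * size (filter (keep f) es).
Proof.
move=> sw; case: (boolP [exists f, size es <= 81 * size (filter (keep f) es)]).
  by case/existsP => f; exists f.
rewrite negb_exists => /forallP H.
have : size es * 3 ^ #|V| <= 81 * \sum_(f : {ffun V -> 'I_3}) size (filter (keep f) es).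
  have -> : \sum_f size (filter (keep f) es) = \sum_(e <- es) #|[set f | keep f e]|.
    under eq_bigr do rewrite size_filter -sum1_count big_mkcond.
    by rewrite exchange_big; apply: eq_bigr => e _; rewrite -big_mkcond sum1dep_card.
  elim: es sw {H} => [|e es IH] /=; first by rewrite big_nil.
  move=> /andP[/card_keep he /IH hes]; rewrite big_cons mulSn mulnDr; exact: leq_add.
have -> : size es * 3 ^ #|V| = \sum_(f : {ffun V -> 'I_3}) size es.
  by rewrite sum_nat_const card_ffun card_ord mulnC.
have : \sum_(f : {ffun V -> 'I_3}) (81 * size (filter (keep f) es) + 1)
    <= \sum_(f : {ffun V -> 'I_3}) size es.
  by apply: leq_sum => f _; rewrite addn1 ltnNge H.
rewrite big_split /= -big_distrr /= sum1_card card_ffun card_ord.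
have : 0 < 3 ^ #|V| by rewrite expn_gt0.
lia.
Qed.

End Chains.

(** * Circulations in the multigraph of swaps *)

Section Closing.
Variables (V : finType) (E : eqType) (src tgt : E -> V).

Definition adj (es : seq E) (u v : V) :=
  has (fun e => ((src e, tgt e) == (u, v)) || ((src e, tgt e) == (v, u))) es.

(* Component labels; the list is processed from its end. *)
Fixpoint rep (es : seq E) : V -> V :=
  if es is e :: es' then
    fun z => if rep es' z == rep es' (src e) then rep es' (tgt e) else rep es' z
  else id.

(** The cycle rank: an edge counts if the edges after it in the list already connect its ends. *)
Fixpoint closing (es : seq E) : nat :=
  if es is e :: es' then (rep es' (src e) == rep es' (tgt e)) + closing es' else 0.

Lemma adj_sym es : symmetric (adj es).
Proof. by move=> u v; apply: eq_has => e; rewrite orbC. Qed.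

Lemma rep_connect es u v : rep es u = rep es v -> connect (adj es) u v.
Proof.
elim: es u v => [|e es IH] u v /=; first by move=> ->; exact: connect0.
have sub x y : connect (adj es) x y -> connect (adj (e :: es)) x y.
  by apply: connect_sub => a b ab; apply: connect1; rewrite /adj /= -/(adj es a b) ab orbT.
have eE : connect (adj (e :: es)) (src e) (tgt e).
  by apply: connect1; rewrite /adj /= eqxx.
have cs : connect_sym (adj (e :: es)) by apply: sym_connect_sym; exact: adj_sym.
case: eqP => [/IH/sub us|_]; case: eqP => [/IH/sub vs|_].
- by move=> _; apply: connect_trans us _; rewrite cs.
- by move=> /IH/sub tv; apply: connect_trans us _; apply: connect_trans eE tv.
- by move=> /IH/sub ut; apply: connect_trans ut _; rewrite cs; apply: connect_trans vs eE.
- by move/IH/sub.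
Qed.

(** An edge that closes no cycle merges two labels, so it lowers the number of labels on [B] by at
    least one, starting from [#|B|] labels. *)
Lemma size_closing es (B : {set V}) : all (fun e => (src e \in B) && (tgt e \in B)) es ->
  size es <= closing es + #|B|.
Proof.
move=> eB; suff : size es + #|rep es @: B| <= closing es + #|B|.
  by apply: leq_trans; rewrite leq_addr.
elim: es eB => [|e es IH] /=; first by rewrite !add0n leq_imset_card.
move=> /andP[/andP[sB tB] /IH {}IH]; case: eqP => [E0|/eqP ne].
  rewrite -addnA add1n addSn ltnS; apply: leq_trans IH; rewrite leq_add2l.
  apply/subset_leq_card/subsetP => _ /imsetP[z zB ->]; case: eqP => _; exact: imset_f.
rewrite add0n; apply: leq_trans IH; rewrite addSnnS leq_add2l.
rewrite [leqRHS](cardsD1 (rep es (src e))) imset_f // ltnS.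
apply/subset_leq_card/subsetP => _ /imsetP[z zB ->]; case: eqP => [_|/eqP h].
  by rewrite !inE eq_sym ne imset_f.
by rewrite !inE h imset_f.
Qed.

End Closing.

Section Circulations.
Variables (V : finType) (mv : nat -> V * V) (U : nat -> {set V}) (l : nat).
Hypothesis HU : swap_seq mv U l.
Local Open Scope ring_scope.
Implicit Types (c : {ffun 'I_l -> int}).

Definition boundary c u : int := \sum_t c t * flow mv (t : 'I_l) u.
(** The coefficient of the weight of the edge [{x, y}] in the sum of the improvements weighted by
    [c]. *)
Definition response c x y : int := \sum_t c t * gain U (t : 'I_l) x y.
Definition norm1 c : nat := (\sum_t `|c t|)%N.

Lemma boundaryD c c' u : boundary (c + c') u = boundary c u + boundary c' u.
Proof. by rewrite -big_split; apply: eq_bigr => t _; rewrite ffunE mulrDl. Qed.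
Lemma boundaryN c u : boundary (- c) u = - boundary c u.
Proof. by rewrite -sumrN; apply: eq_bigr => t _; rewrite ffunE mulNr. Qed.
Lemma responseD c c' x y : response (c + c') x y = response c x y + response c' x y.
Proof. by rewrite -big_split; apply: eq_bigr => t _; rewrite ffunE mulrDl. Qed.
Lemma responseN c x y : response (- c) x y = - response c x y.
Proof. by rewrite -sumrN; apply: eq_bigr => t _; rewrite ffunE mulNr. Qed.
Lemma norm1D c c' : (norm1 (c + c')%R <= norm1 c + norm1 c')%N.
Proof. by rewrite -big_split leq_sum // => t _; rewrite ffunE -lez_nat PoszD !abszE ler_normD. Qed.
Lemma norm1N c : norm1 (- c) = norm1 c.
Proof. by apply: eq_bigr => t _; rewrite ffunE abszN. Qed.

(** The factors [flow] orient both moves alike at [node e], whose own boundary then cancels; a unit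
    flow between the two partners remains. *)
Definition pulse (e : switch V l) : {ffun 'I_l -> int} :=
  [ffun t => flow mv (time1 e) (node e) *+ (t == time1 e)
           - flow mv (time2 e) (node e) *+ (t == time2 e)].

Lemma pulse_sum e (F : 'I_l -> int) : \sum_t pulse e t * F t =
  flow mv (time1 e) (node e) * F (time1 e) - flow mv (time2 e) (node e) * F (time2 e).
Proof.
have D (G : 'I_l -> int) t0 : \sum_t G t *+ (t == t0) = G t0.
  by rewrite (bigD1 t0) //= eqxx big1 ?addr0 // => t /negbTE->.
rewrite -(D (fun t => _ * F t)) -(D (fun t => _ * F t) (time2 e)) -sumrB.
by apply: eq_bigr => t _; rewrite ffunE mulrBl !mulrnAl.
Qed.

Lemma norm1_pulse e : (norm1 (pulse e) <= 2)%N.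
Proof.
have D (G : 'I_l -> nat) t0 : (\sum_t G t * (t == t0) = G t0)%N.
  by rewrite (bigD1 t0) //= eqxx big1 ?addn0 ?muln1 // => t /negbTE->; rewrite muln0.
apply: (@leq_trans (\sum_t (1 * (t == time1 e) + 1 * (t == time2 e)))).
  apply: leq_sum => t _; rewrite ffunE /flow !mul1n.
  by case: (t == time1 e); case: (t == time2 e); do ?case: ifP.
by rewrite big_split /= !(D (fun=> 1%N)).
Qed.

Definition source (e : switch V l) := partner mv (time1 e) (node e).
Definition target (e : switch V l) := partner mv (time2 e) (node e).

Lemma boundary_pulse e u : switching mv U e ->
  boundary (pulse e) u = (u == target e)%:R - (u == source e)%:R.
Proof.
case/and3P => ax bx _; rewrite /boundary pulse_sum.
have F (t : 'I_l) : touches mv t (node e) ->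
    flow mv t (node e) * flow mv t u = (u == node e)%:R - (u == partner mv t (node e))%:R.
  move=> tx; case: (eqVneq u (node e)) => [->|ux].
    rewrite (flow_sqr (ltn_ord t) tx) eq_sym (negbTE (partner_neq HU (ltn_ord t) tx)).
    by rewrite subr0.
  case: (eqVneq u (partner mv t (node e))) => [->|uz].
    by rewrite (flow_partner HU) // mulrN (flow_sqr (ltn_ord t) tx) sub0r.
  rewrite (flow_out (x := u)) ?mulr0 ?subr0 //.
  by rewrite (touchesE HU _ (ltn_ord t) tx) negb_or ux.
by rewrite !F // /source /target; ring.
Qed.

(** Membership in the span of the pulses of [es], recorded through the vanishing of responses that
    it implies. *)
Definition within (es : seq (switch V l)) c := forall x y,
  (forall e, e \in es -> response (pulse e) x y = 0) -> response c x y = 0.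

(** The signed pulses along a path add up, and their boundaries telescope. The path is first made
    simple, so that it has fewer than [#|V|] edges of norm at most 2. *)
Lemma connect_flow es u v : all (@switching V mv U l) es -> connect (adj source target es) u v ->
  exists c, [/\ forall w, boundary c w = (w == v)%:R - (w == u)%:R,
    (norm1 c <= 2 * #|V|)%N & within es c].
Proof.
move=> /allP sw /connectP[p0 /shortenP[p pp up _] ->] {p0}.
suff [c [h1 h2 h3]] : exists c, [/\ forall w, boundary c w = (w == last u p)%:R - (w == u)%:R,
    (norm1 c <= 2 * size p)%N & within es c].
  exists c; split=> //; apply: leq_trans h2 _; rewrite leq_mul2l /=.
  by apply: leq_trans (max_card [in u :: p]); rewrite (card_uniqP up) /= leqnSn.
elim: p u pp {up} => [|z p IH] u /=.
  exists 0; split => [w||x y _]; rewrite ?subrr /boundary /norm1 /response ?big1 // => t _;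
  by rewrite ffunE ?mul0r.
move=> /andP[uz /IH[c [h1 h2 h3]]].
suff [c' [h1' h2' h3']] : exists c', [/\ forall w, boundary c' w = (w == z)%:R - (w == u)%:R,
    (norm1 c' <= 2)%N & within es c'].
  exists (c' + c); split => [w||x y H].
  - by rewrite boundaryD h1 h1' addrC addrA subrK.
  - by apply: leq_trans (norm1D _ _) _; rewrite mulnS leq_add.
  - by rewrite responseD h3 // h3' // addr0.
case/hasP: uz => e ee /orP[] /eqP[<- <-].
  exists (pulse e); split => [w||x y]; last exact.
    by rewrite boundary_pulse ?sw.
  exact: norm1_pulse.
exists (- pulse e); split => [w||x y H].
- by rewrite boundaryN boundary_pulse ?sw // opprB.
- by rewrite norm1N norm1_pulse.
- by rewrite responseN H ?oppr0.
Qed.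

Definition circulation c := [forall u, boundary c u == 0].

(* A circulation together with its pivot pair. *)
Definition probe : Type := {ffun 'I_l -> int} * V * V.

Definition triangular (L : seq probe) :=
  pairwise (fun p q : probe => response q.1.1 p.1.2 p.2 == 0) L.

(** The bound on [norm1] is that of a simple path of pulses plus the pulse closing it. *)
Definition good_probe (p : probe) := [&& circulation p.1.1,
  (norm1 p.1.1 <= 2 * #|V| + 2)%N, p.1.2 != p.2 & response p.1.1 p.1.2 p.2 != 0].

(** A closing switch [e] gives the circulation made of its pulse and a path of later pulses from its
    target back to its source. The later pulses do not respond at the pivot [(node e, witness e)],
    so the response there is that of [pulse e] alone, and later circulations vanish there. *)
Lemma closing_probes es : all (@switching V mv U l) es ->
  pairwise (fun e e' => response (pulse e') (node e) (witness e) == 0) es ->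
  all (fun e => response (pulse e) (node e) (witness e) != 0) es ->
  exists L : seq probe, [/\ size L = closing source target es, all good_probe L,
    triangular L & forall p, p \in L -> within es p.1.1].
Proof.
elim: es => [|e es IH]; first by exists [::].
rewrite [closing _ _ _]/= => /andP[se ses] /andP[pe pes] /andP[re res].
have [L [sL gL tL wL]] := IH ses pes res.
have wL' p : p \in L -> within (e :: es) p.1.1.
  by move=> /wL w x y H; apply: w => e' e'es; apply: H; rewrite inE e'es orbT.
case: eqP => [/esym/rep_connect E|_]; last by exists L; split.
have [c [bc nc wc]] := connect_flow ses E.
have zero c' : within es c' -> response c' (node e) (witness e) = 0.
  by apply=> e' /(allP pe) /eqP.
exists ((pulse e + c, node e, witness e) :: L); split => /=.
- by rewrite sL.
- rewrite gL andbT /good_probe /=; apply/and4P; split.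
  + apply/forallP => u; rewrite boundaryD bc boundary_pulse //.
    by rewrite addrA subrK subrr.
  + by apply: leq_trans (norm1D _ _) _; rewrite addnC leq_add // norm1_pulse.
  + by case/and4P: se => _ _; rewrite eq_sym => ->.
  + by rewrite responseD (zero c wc) addr0.
- by rewrite tL andbT; apply/allP => p /wL /zero ->.
move=> p; rewrite inE => /orP[/eqP->|/wL' //] x y H /=.
rewrite responseD H ?mem_head // wc ?addr0 // => e' e'es.
by apply: H; rewrite inE e'es orbT.
Qed.

End Circulations.

(** * Probes from sets of moves of high minimum degree *)

Section Dense.
Variables (V : finType) (mv : nat -> V * V) (l : nat).

Definition degree (M : {set 'I_l}) x := #|[set t in M | touches mv (t : 'I_l) x]|.

Definition support (M : {set 'I_l}) := [set x | 0 < degree M x].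

Section Probes.
Variable U : nat -> {set V}.
Hypothesis HU : swap_seq mv U l.
Hypothesis Uinj : forall t t', t <= l -> t' <= l -> U t = U t' -> t = t'.

(** The moves of [e'] touch only nodes of colours 0 and 1, never the witness of [e], which has
    colour 2; and they touch [node e], of colour 0, only if it equals [node e']. *)
Lemma response_pulse f (e e' : switch V l) : keep mv f e -> keep mv f e' -> switching mv U e' ->
  response U (pulse mv e') (node e) (witness e) =
  (if node e == node e' then
    level mv U (node e') (time1 e') (witness e) - level mv U (node e') (time2 e') (witness e)
  else 0)%R.
Proof.
move=> /and4P[/eqP f1 _ _ /eqP f4] /and4P[/eqP g1 /eqP g2 /eqP g3 _] /and3P[tx1 tx2 _].
rewrite /response pulse_sum.
have F (t : 'I_l) : touches mv t (node e') -> f (partner mv t (node e')) = 1 :> nat ->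
    (flow mv t (node e') * gain U t (node e) (witness e) =
     if node e == node e' then level mv U (node e') t (witness e) else 0)%R.
  move=> tx g.
  have ny : ~~ touches mv t (witness e).
    rewrite (touchesE HU _ (ltn_ord t) tx) negb_or; apply/andP; split; apply/eqP => E.
      by move: f4; rewrite E g1.
    by move: f4; rewrite E g.
  case: eqP => [->|/eqP nx].
    rewrite (gain_touch HU (ltn_ord t) tx ny) mulrA (flow_sqr (ltn_ord t) tx) mul1r /level.
    by case: eqP => // E; move: ny; rewrite E (partner_touches HU).
  have nx' : ~~ touches mv t (node e).
    rewrite (touchesE HU _ (ltn_ord t) tx) negb_or nx; apply/eqP => E.
    by move: f1; rewrite E g.
  by rewrite (gain_out HU (ltn_ord t) nx' ny) mulr0.
by rewrite !F //; case: eqP => //; rewrite subrr.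
Qed.

(** There are [R] switches per node of the support. The colouring keeps one in 81 of them, hence at
    least [2 * #|support M|], and at most [#|support M|] of these close no cycle, since all partners
    lie in the support. *)
Lemma dense_probes R (M : {set 'I_l}) : 162 <= R ->
  (forall x, x \in support M -> 3 ^ R <= degree M x) ->
  exists L : seq (probe V l), [/\ #|support M| <= size L, all (@good_probe V mv U l) L
    & triangular U L].
Proof.
move=> R162 HM.
have [x|es [ses aes pes]] := chains HU Uinj (enum_uniq (mem (support M))) (R := R) (M := M).
  by rewrite mem_enum => /HM.
have sw : all (@switching V mv U l) es by apply: sub_all aes => e /andP[].
have [f fes] := keep_many HU sw.
pose es' := filter (keep mv f) es.
have aes' : all (fun e => [&& switching mv U e, keep mv f e, time1 e \in M & time2 e \in M]) es'.
  apply/allP => e; rewrite mem_filter => /andP[ke /(allP aes) /and4P[? _ ? ?]].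
  exact/and4P.
have sw' : all (@switching V mv U l) es' by apply: sub_all aes' => e /andP[].
have [||L [sL gL tL _]] := closing_probes HU sw'.
- have := pairwise_filter (keep mv f) pes; rewrite -/es'.
  have : all (fun e => [&& switching mv U e, keep mv f e, time1 e \in M & time2 e \in M]) es' := aes'.
  elim: (es') => //= e es0 IH /andP[/and4P[_ ke _ _] a0] /andP[p0 q0].
  rewrite IH // andbT; apply/allP => e' e'0.
  have /and4P[s' k' _ _] := allP a0 _ e'0.
  rewrite (response_pulse ke k' s'); case: (eqVneq (node e) (node e')) => // E.
  have := allP p0 _ e'0; rewrite /blind E eqxx /= => /eqP->.
  by rewrite subrr.
- apply: sub_all aes' => e /and4P[s k _ _]; rewrite (response_pulse k k s) eqxx subr_eq0.
  by case/and4P: s => _ _ _ /and3P[].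
exists L; split => //; rewrite sL.
have touch_support (t : 'I_l) x : t \in M -> touches mv t x -> x \in support M.
  by move=> tM tx; rewrite inE card_gt0; apply/set0Pn; exists t; rewrite inE tM.
have := @size_closing _ _ (source mv (l := l)) (target mv (l := l)) es' (support M).
have -> : all (fun e => (source mv e \in support M) && (target mv e \in support M)) es'.
  apply: sub_all aes' => e /and4P[/and3P[t1 t2 _] _ m1 m2]; apply/andP; split.
    by apply: (touch_support _ _ m1); apply: (partner_touches HU).
  by apply: (touch_support _ _ m2); apply: (partner_touches HU).
move=> /(_ isT); move: fes; rewrite -/es' ses -cardE.
have -> : #|mem (support M)| = #|support M| by apply: eq_card.
have : 162 * #|support M| <= R * #|support M| by rewrite leq_mul2r R162 orbT.
by set a := closing _ _ _; set b := size _; set c := #|_|; set d := R * c; lia.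
Qed.

End Probes.

(* Nodes of degree less than K are deleted one after the other. *)
Lemma prune K (M : {set 'I_l}) : exists M' : {set 'I_l}, [/\ M' \subset M,
  #|M| <= #|M'| + K * #|support M| & forall x, x \in support M' -> K <= degree M' x].
Proof.
have [n] := ubnP #|support M|; elim: n M => // n IH M Mn.
case: (boolP [forall x in support M, K <= degree M x]) => [/forall_inP H|].
  by exists M; split; rewrite ?leq_addr.
rewrite negb_forall_in => /exists_inP[x xM]; rewrite -ltnNge => xK.
pose M1 := M :\: [set t in M | touches mv (t : 'I_l) x].
have M1M : M1 \subset M by apply: subsetDl.
have dM1 y : degree M1 y <= degree M y.
  by apply/subset_leq_card/subsetP => t; rewrite !inE => /andP[/andP[_ ->]].
have sM1 : support M1 \proper support M.
  apply/properP; split.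
    by apply/subsetP => y; rewrite !inE => /leq_trans; apply.
  exists x => //; rewrite inE -leqNgt leqn0 cards_eq0; apply/eqP/setP => t.
  by rewrite !inE; case: (t \in M) => //=; case: (touches _ _ _).
have [|M' [M'M1 cM' HM']] := IH M1; first exact: leq_trans (proper_card sM1) Mn.
exists M'; split => //; first exact: subset_trans M'M1 M1M.
have -> : #|M| = degree M x + #|M1|.
  rewrite /degree -(cardsID [set t in M | touches mv (t : 'I_l) x] M); congr (_ + _).
  by apply: eq_card => t; rewrite !inE; case: (t \in M).
have := proper_card sM1; move: cM' xK.
have : K * (#|support M1|.+1 ) <= K * #|support M| \/ ~ (#|support M1| < #|support M|).
  by case: (ltnP #|support M1| #|support M|) => h; [left; rewrite leq_mul2l h orbT|right].
rewrite mulnS; lia.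
Qed.

End Dense.

(** * Choosing the window *)

Section Windows.
Variables (V : finType) (mv : nat -> V * V) (K0 : nat).

Definition wdegree s l x := \sum_(i < l) touches mv (s + i) x.

Definition heavy s l t :=
  (K0 <= wdegree s l (mv t).1) && (K0 <= wdegree s l (mv t).2).

Definition heavies s l := \sum_(i < l) heavy s l (s + i).

(** Moves that become heavy only when the two halves of the window are joined; the conditional
    selects the half that contains [t]. *)
Definition fresh s l t :=
  heavy s (l + l) t && ~~ heavy (if t < s + l then s else s + l) l t.

Definition freshes s l := \sum_(i < l + l) fresh s l (s + i).

Lemma heavies_split s l :
  heavies s (l + l) <= heavies s l + heavies (s + l) l + freshes s l.
Proof.
rewrite /heavies /freshes !big_split_ord /=.
rewrite addnACA; apply: leq_add; rewrite -big_split /=; apply: leq_sum => i _.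
  by rewrite /fresh ltn_add2l ltn_ord; do 2!case: heavy.
rewrite /fresh addnA ifF; last by rewrite ltnNge leq_addr.
by do 2!case: heavy.
Qed.

(** Suppose more than a fraction [h / (4 * H)] of the moves is heavy. Unless the fresh moves of the
    top scale suffice, one half keeps a fraction above [(h - 1) / (4 * H)]. At length 1 no move is
    heavy, as [1 < K0], so the halving must stop before. *)
Lemma fresh_window H h s : 1 < K0 -> 2 ^ h * h < 4 * H * heavies s (2 ^ h) ->
  exists i s', [/\ i < h, s <= s', s' + 2 ^ i.+1 <= s + 2 ^ h
    & 2 ^ i.+1 <= 4 * H * freshes s' (2 ^ i)].
Proof.
move=> K1; elim: h s => [|h IH] s.
  rewrite muln0 /heavies expn0 big_ord1 /heavy /wdegree !big_ord1.
  have E (b : bool) : (K0 <= b) = false by case: b; lia.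
  by rewrite !E muln0.
move=> Hh; case: (leqP (2 ^ h.+1) (4 * H * freshes s (2 ^ h))) => [F|F].
  by exists h, s.
have := heavies_split s (2 ^ h); move: Hh F; rewrite !expnS !mul2n -!addnn.
set l := 2 ^ h in IH *; move=> Hh F HS.
have [h1|h1] := ltnP (l * h) (4 * H * heavies s l).
  by have [i [s' [? ? ? ?]]] := IH _ h1; exists i, s'; split => //; lia.
have [h2|h2] := ltnP (l * h) (4 * H * heavies (s + l) l).
  by have [i [s' [? ? ? ?]]] := IH _ h2; exists i, s'; split => //; lia.
have := leq_mul (leqnn (4 * H)) HS; rewrite !mulnDr; lia.
Qed.

Lemma sum_touches t : \sum_x touches mv t x <= 2.
Proof.
have D y : \sum_x (x == y :> V) = 1.
  by rewrite (bigD1 y) //= eqxx big1 // => x /negbTE->.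
apply: (@leq_trans (\sum_x ((x == (mv t).1) + (x == (mv t).2)))).
  by apply: leq_sum => x _; rewrite /touches; do 2!case: eqP.
by rewrite big_split /= !D.
Qed.

(** A move that is not heavy is charged to an endpoint of degree below [K0], and such a node is
    charged fewer than [K0] times. *)
Lemma heavies_ge l : 1 < K0 -> l <= heavies 0 l + #|V| * K0.
Proof.
move=> K1; rewrite -{1}(card_ord l) -sum1_card.
apply: (@leq_trans (\sum_(i < l) (heavy 0 l i +
    \sum_x touches mv i x * (wdegree 0 l x < K0)))).
  apply: leq_sum => i _; rewrite /heavy; case: (leqP K0) => h1 /=.
    case: (leqP K0) => h2 //=; rewrite (bigD1 (mv i).2) //= h2.
    by rewrite /touches eqxx orbT.
  by rewrite (bigD1 (mv i).1) //= h1 /touches eqxx.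
rewrite big_split leq_add // exchange_big /=.
rewrite -sum_nat_const; apply: leq_sum => x _; rewrite -big_distrl /=.
by case: leqP => h; rewrite ?muln0 // muln1; apply: ltnW.
Qed.

Section Charge.
Variables (s l : nat).
Let mv' t := mv (s + t).

Lemma card_fresh : #|[set t : 'I_(l + l) | fresh s l (s + t)]| = freshes s l.
Proof. by rewrite /freshes -sum1dep_card big_mkcond; apply: eq_bigr => i _; case: fresh. Qed.

(* A move of M' is charged to an endpoint that is light in the half window
   containing the move; in each half a node is charged less than K0 times. *)
Lemma card_fresh_le (M : {set 'I_(l + l)}) :
  (forall t, t \in M -> fresh s l (s + t)) ->
  #|M| <= #|support mv' M| * (K0 + K0).
Proof.
move=> HM; pose light (t : 'I_(l + l)) x :=
  wdegree (if s + t < s + l then s else s + l) l x < K0.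
rewrite -sum1_card; apply: (@leq_trans (\sum_(t in M) \sum_(x in support mv' M)
    (touches mv' t x && light t x))).
  apply: leq_sum => t tM; have := HM t tM; rewrite /fresh => /andP[_].
  have sup x : touches mv' t x -> x \in support mv' M.
    by move=> tx; rewrite inE card_gt0; apply/set0Pn; exists t; rewrite inE tM.
  rewrite negb_and -!ltnNge => /orP[] h.
    have t1 : touches mv' t (mv' t).1 by rewrite /touches eqxx.
    by rewrite (bigD1 _ (sup _ t1)) /= t1 /light h.
  have t2 : touches mv' t (mv' t).2 by rewrite /touches eqxx orbT.
  by rewrite (bigD1 _ (sup _ t2)) /= t2 /light h.
rewrite exchange_big /= -sum_nat_const; apply: leq_sum => x _.
apply: (@leq_trans (\sum_(t < l + l) (touches mv' t x && light t x))).
  by rewrite [leqRHS](bigID (mem M)) /= leq_addr.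
rewrite big_split_ord /=; apply: leq_add.
  apply: (@leq_trans (wdegree s l x * (wdegree s l x < K0))); last first.
    by case: leqP => h; rewrite ?muln0 // muln1 ltnW.
  rewrite {1}/wdegree big_distrl /=; apply: leq_sum => i _.
  by rewrite /light /= ltn_add2l ltn_ord mulnb.
apply: (@leq_trans (wdegree (s + l) l x * (wdegree (s + l) l x < K0))); last first.
  by case: leqP => h; rewrite ?muln0 // muln1 ltnW.
rewrite {1}/wdegree big_distrl /=; apply: leq_sum => i _.
rewrite /light /= ifF; last by rewrite ltn_add2l ltnNge leq_addr.
by rewrite mulnb -addnA.
Qed.

(** Both ends of a fresh move have degree at least [K0] in the window, and the degrees over its
    [l + l] moves sum to at most [4 * l]. *)
Lemma support_fresh_le :
  K0 * #|support mv' [set t : 'I_(l + l) | fresh s l (s + t)]| <= 4 * l.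
Proof.
rewrite mulnC -sum_nat_const.
apply: (@leq_trans (\sum_x wdegree s (l + l) x)).
  rewrite [leqRHS](bigID (mem (support mv' [set t : 'I_(l + l) | fresh s l (s + t)]))) /=.
  apply: leq_trans (leq_addr _ _); apply: leq_sum => x.
  rewrite inE card_gt0 => /set0Pn[t]; rewrite !inE => /andP[/andP[/andP[h1 h2] _]].
  by rewrite /touches => /orP[] /eqP->.
rewrite exchange_big /=; apply: (@leq_trans (\sum_(i < l + l) 2)).
  by apply: leq_sum => i _; apply: sum_touches.
by rewrite sum_nat_const card_ord; lia.
Qed.

End Charge.
End Windows.

Section Main.
Variables (V : finType) (mv : nat -> V * V) (U : nat -> {set V}).

(** At full length at least half of the moves are heavy, so some window of length [2 * l] has at
    least [l / (2 * h)] fresh moves. Their support has at most [4 * l / K0] nodes, so with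
    [K0 = 16 * K * h] pruning to degree [K] deletes at most [l / (4 * h)] of them. The remaining
    [l / (4 * h)] moves need a support of at least [l / (8 * h * K0)] nodes by [card_fresh_le], each
    worth a probe. *)
Lemma rich_window R K h : 162 <= R -> 3 ^ R <= K -> 0 < h ->
  2 * #|V| * (16 * K * h) <= 2 ^ h -> swap_seq mv U (2 ^ h) ->
  (forall t t', t <= 2 ^ h -> t' <= 2 ^ h -> U t = U t' -> t = t') ->
  exists i s (L : seq (probe V (2 ^ i))), [/\ i <= h, s + 2 ^ i <= 2 ^ h,
    2 ^ i <= 256 * K * h ^ 2 * size L,
    all (good_probe (fun t => mv (s + t)) (fun t => U (s + t)) (l := 2 ^ i)) L
  & triangular (fun t => U (s + t)) L].
Proof.
move=> R162 RK h0 hN HU Uinj; pose K0 := 16 * K * h.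
have K1 : 0 < K by apply: leq_trans RK; rewrite expn_gt0.
have K01 : 1 < K0 by have : 0 < K * h by [rewrite muln_gt0 K1]; rewrite /K0; lia.
have big : 2 ^ h * h < 4 * h * heavies mv K0 0 (2 ^ h).
  have := heavies_ge mv (2 ^ h) K01; rewrite -/K0 in hN.
  have : 0 < 2 ^ h by rewrite expn_gt0.
  set N := 2 ^ h in hN *; set G := heavies _ _ _ _ => N0 HG.
  have : 2 * G >= N by lia.
  move=> G2; have : h * N < h * (4 * G) by rewrite ltn_mul2l h0 /=; lia.
  by lia.
have [i [s [ih _ sN hF]]] := fresh_window K01 big; rewrite add0n in sN.
exists i.+1, s; rewrite expnS mul2n -addnn in sN hF *; set l := 2 ^ i in sN hF *.
have HU' : swap_seq (fun t => mv (s + t)) (fun t => U (s + t)) (l + l).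
  by move=> t tl; rewrite addnS; apply: HU; apply: leq_trans sN; rewrite ltn_add2l.
have Uinj' t t' : t <= l + l -> t' <= l + l -> U (s + t) = U (s + t') -> t = t'.
  move=> tl tl' /Uinj E; apply/eqP; rewrite -(eqn_add2l s); apply/eqP/E.
    by apply: leq_trans sN; rewrite leq_add2l.
  by apply: leq_trans sN; rewrite leq_add2l.
pose M0 := [set t : 'I_(l + l) | fresh mv K0 s l (s + t)].
have [M [MM0 cM HM]] := prune (fun t => mv (s + t)) K M0.
have [x xM|L [sL gL tL]] := dense_probes HU' Uinj' R162 (M := M).
  exact: leq_trans RK (HM x xM).
exists L; split => //.
have c1 := support_fresh_le mv K0 s l.
have c2 : #|M| <= #|support (fun t => mv (s + t)) M| * (K0 + K0).
  by apply: card_fresh_le => t /(subsetP MM0); rewrite inE.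
move: cM; rewrite card_fresh -/M0 in c1 * => cM.
have e1 : 4 * h * (K * #|support (fun t => mv (s + t)) M0|) <= l.
  by move: c1; rewrite /K0; lia.
have e2 : l <= 4 * h * #|M|.
  have := leq_mul (leqnn (4 * h)) cM; rewrite mulnDr; lia.
have e3 : 4 * h * #|M| <= 4 * h * (size L * (K0 + K0)).
  by rewrite leq_mul2l (leq_trans c2) ?orbT // leq_mul2r sL orbT.
by move: (leq_trans e2 e3); rewrite /K0; lia.
Qed.

End Main.

(** * Responses of circulations depend on the moves only *)

Section ResponseMoves.
Variables (V : finType) (mv : nat -> V * V) (l : nat).
Local Open Scope ring_scope.
Implicit Types (c : {ffun 'I_l -> int}) (U : nat -> {set V}).

Lemma swap_parity U x t : swap_seq mv U l -> (t <= l)%N ->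
  (x \in U t) = (x \in U 0%N) (+) odd (\sum_(i < t) touches mv i x).
Proof.
move=> HU; elim: t => [|t IH] tl; first by rewrite big_ord0 addbF.
by rewrite (swap_flip HU) // IH ?(ltnW tl) // big_ord_recr /= oddD oddb addbA.
Qed.

(** As [y] keeps its side, each gain is the flow at [x] times a constant sign, and the sum is a
    multiple of the boundary at [x]. *)
Lemma response_untouched U c x y : swap_seq mv U l -> circulation mv c ->
  (forall t, (t < l)%N -> ~~ touches mv t y) -> response U c x y = 0.
Proof.
move=> HU /forallP /(_ x) /eqP cx Hy.
rewrite /response (eq_bigr (fun t : 'I_l => c t * flow mv t x * side (U 0%N) y)).
  by rewrite -mulr_suml; move: cx; rewrite /boundary => ->; rewrite mul0r.
move=> t _; rewrite -mulrA; congr (_ * _).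
have -> : side (U 0%N) y = side (U t) y.
  rewrite /side (swap_parity y HU (ltnW (ltn_ord t))) big1 ?addbF // => i _.
  by rewrite (negbTE (Hy i _)) // (ltn_trans (ltn_ord i)).
case: (boolP (touches mv t x)) => tx; first by rewrite (gain_touch HU) // Hy.
by rewrite (gain_out HU) ?Hy // (flow_out tx) mul0r.
Qed.

(** A single move of [x] reveals its side at that time, and the parity of its moves carries this to
    all other times. *)
Lemma same_side U U' x : swap_seq mv U l -> swap_seq mv U' l ->
  (exists2 t, (t < l)%N & touches mv t x) ->
  forall t, (t <= l)%N -> (x \in U t) = (x \in U' t).
Proof.
move=> HU HU' [t tl tx].
have E0 : (x \in U 0%N) = (x \in U' 0%N).
  have := touches_side HU tl tx; rewrite -(touches_side HU' tl tx).
  by rewrite (swap_parity x HU (ltnW tl)) (swap_parity x HU' (ltnW tl)) => /addIb.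
by move=> t' tl'; rewrite (swap_parity x HU tl') (swap_parity x HU' tl') E0.
Qed.

(* This lets the union bound run over sequences of swaps, without the initial
   partitions. *)
Lemma response_moves U U' c x y : swap_seq mv U l -> swap_seq mv U' l ->
  circulation mv c -> response U c x y = response U' c x y.
Proof.
move=> HU HU' cc.
have C W : response W c x y = response W c y x.
  by rewrite /response; apply: eq_bigr => t _; rewrite gainC.
have dec z : (exists2 t, (t < l)%N & touches mv t z) \/ forall t, (t < l)%N -> ~~ touches mv t z.
  case: (boolP [exists t : 'I_l, touches mv t z]) => [/existsP[t tz]|H].
    by left; exists t.
  by right=> t tl; move: H; rewrite negb_exists => /forallP /(_ (Ordinal tl)).
case: (dec y) => [ty|ny]; last by rewrite !response_untouched.
case: (dec x) => [tx|nx]; last by rewrite !C !response_untouched.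
rewrite /response; apply: eq_bigr => t _; congr (_ * _); rewrite /gain.
by rewrite !(same_side HU HU' tx) ?(same_side HU HU' ty) // ltnW.
Qed.

End ResponseMoves.

(** * Small ball probabilities *)

Section DiscreteSmallBall.
Local Open Scope ring_scope.
Variables (R : realFieldType) (E : finType) (m : nat) (p : E -> 'I_m -> R) (q : R).
Hypothesis p0 : forall e j, 0 <= p e j.
Hypothesis p1 : forall e, \sum_j p e j = 1.
Hypothesis pq : forall e j, p e j <= q.
Hypothesis q0 : 0 <= q.
Implicit Types (z : {ffun E -> 'I_m}).

Definition weight z := \prod_e p e (z e).

Definition upd z e j : {ffun E -> 'I_m} := [ffun e' => if e' == e then j else z e'].

Lemma weight_ge0 z : 0 <= weight z.
Proof. exact: prodr_ge0. Qed.

Lemma sum_weight : \sum_z weight z = 1.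
Proof.
rewrite -(bigA_distr_bigA (fun e j => p e j)) /=.
by apply: big1 => e _; rewrite p1.
Qed.

(* Coordinate e is drawn twice, and the two draws are exchanged. *)
Lemma sum_resample e (G : {ffun E -> 'I_m} -> R) :
  \sum_z G z = \sum_(z : {ffun E -> 'I_m}) p e (z e) * \sum_j G (upd z e j).
Proof.
have -> : \sum_z G z = \sum_z \sum_j p e j * G z.
  by apply: eq_bigr => z _; rewrite -mulr_suml p1 mul1r.
under [RHS]eq_bigr do rewrite mulr_sumr.
rewrite !pair_big /=.
pose sw (zj : {ffun E -> 'I_m} * 'I_m) := (upd zj.1 e zj.2, zj.1 e).
have swK : involutive sw.
  move=> [z j]; rewrite /sw /= /upd ffunE eqxx; congr (_, _).
  by apply/ffunP => e'; rewrite !ffunE; case: eqP => // ->.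
rewrite (reindex_inj (inv_inj swK)) /=.
by apply: eq_bigr => -[z j] _ /=.
Qed.

(** The factor [p e (z e)] is bounded by [q]; resampling coordinate [e] then counts the at most [k]
    values that [A] permits, while [B] is unaffected. *)
Lemma weight_step e (A B : pred {ffun E -> 'I_m}) k :
  (forall z j, B (upd z e j) = B z) ->
  (forall z, #|[set j | A (upd z e j)]| <= k)%N ->
  \sum_(z | A z && B z) weight z <= (k%:R * q) * \sum_(z | B z) weight z.
Proof.
move=> HB HA; pose W' z := \prod_(e' | e' != e) p e' (z e').
have Ww z : weight z = p e (z e) * W' z by rewrite /weight (bigD1 e).
have W'0 z : 0 <= W' z by exact: prodr_ge0.
have W'u z j : W' (upd z e j) = W' z.
  by apply: eq_bigr => e' /negbTE ne; rewrite ffunE ne.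
apply: (@le_trans _ _ (q * \sum_z (A z && B z)%:R * W' z)).
  rewrite mulr_sumr big_mkcond /=; apply: ler_sum => z _.
  case: (A z && B z); last by rewrite mul0r mulr0.
  by rewrite mul1r Ww ler_wpM2r.
rewrite (sum_resample e) [_ * q]mulrC -mulrA mulr_sumr mulr_sumr mulr_sumr [leRHS]big_mkcond /=.
apply: ler_sum => z _.
have -> : \sum_j (A (upd z e j) && B (upd z e j))%:R * W' (upd z e j)
   = (B z)%:R * W' z * #|[set j | A (upd z e j)]|%:R.
  rewrite -sum1dep_card natr_sum mulr_sumr [RHS]big_mkcond /=.
  by apply: eq_bigr => j _; rewrite HB W'u; case: (A _) => /=; rewrite ?mul0r ?mulr1.
case: (B z); last by rewrite !mul0r !mulr0.
rewrite ler_wpM2l // mul1r mulrA -Ww mulrC ler_wpM2r ?weight_ge0 //.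
by rewrite ler_nat.
Qed.

Lemma card_int_window (a r : int) (T : nat) : a != 0 ->
  (#|[set j : 'I_m | (`|a * (j : nat)%:Z + r| <= T%:Z)%R]| <= (2 * T).+1)%N.
Proof.
move=> a0; pose g (j : 'I_m) : 'I_(2 * T).+1 := inord `|(a * (j : nat)%:Z + r + T%:Z)%R|%N.
rewrite -[leqRHS]card_ord -(card_in_imset (f := g)) ?max_card // => j j'.
rewrite !inE => h h' /(congr1 val); rewrite /= !inordK; [|lia|lia] => E0.
apply/val_inj/eqP; rewrite /= -eqz_nat -(inj_eq (mulfI a0)); apply/eqP; lia.
Qed.

(** Coefficients, pivot coordinate and constant term. *)
Definition form : Type := {ffun E -> int} * E * int.

Definition small (T : nat) (f : form) z :=
  `|\sum_e f.1.1 e * (z e : nat)%:Z + f.2| <= T%:Z.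

(** The pivot of the first form does not occur in the later ones, so [weight_step] splits off one
    factor: with the other coordinates fixed, at most [2 * T + 1] values of the pivot make the first
    form small. *)
Lemma discrete_small_ball T (L : seq form) :
  all (fun f : form => f.1.1 f.1.2 != 0) L ->
  pairwise (fun f g : form => g.1.1 f.1.2 == 0) L ->
  \sum_(z | all (small T ^~ z) L) weight z <= (((2 * T).+1)%:R * q) ^+ size L.
Proof.
elim: L => [|f L IH] /=; first by rewrite sum_weight.
move=> /andP[f0 L0] /andP[fL LL]; rewrite exprS.
have := @weight_step f.1.2 (small T f) (fun z => all (small T ^~ z) L) (2 * T).+1 _ _.
move=> step; apply: le_trans (step _ _) _.
- move=> z j /=; apply: eq_in_all => g /(allP fL) /eqP g0.
  rewrite /small; congr (`|_ + _| <= _); apply: eq_bigr => e _; rewrite ffunE.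
  by case: eqP => // ->; rewrite g0 !mul0r.
- move=> z; have := @card_int_window (f.1.1 f.1.2) (\sum_(e | e != f.1.2) f.1.1 e * (z e : nat)%:Z + f.2) T f0.
  apply: leq_trans; apply/subset_leq_card/subsetP => i; rewrite !inE /small.
  rewrite (bigD1 f.1.2) //= ffunE eqxx addrA.
  by rewrite (eq_bigr (fun e => f.1.1 e * (z e : nat)%:Z)) // => e /negbTE ne; rewrite ffunE ne.
by rewrite ler_wpM2l ?mulr_ge0 // IH.
Qed.
End DiscreteSmallBall.

From mathcomp Require Import all_classical all_reals all_analysis measurable_realfun.

Import numFieldNormedType.Exports.

Local Open Scope classical_set_scope.
Local Open Scope ring_scope.

Lemma union_bound (R : realType) (d : measure_display) (T : measurableType d)
    (P : probability T R) (I : Type) (s : seq I) (Q : pred I) (F : I -> set T) :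
  (forall i, measurable (F i)) ->
  (P (\big[setU/set0]_(i <- s | Q i) F i) <= \sum_(i <- s | Q i) P (F i))%E.
Proof.
move=> mF; elim: s => [|i s IH]; first by rewrite !big_nil measure0.
rewrite !big_cons; case: (Q i) => //.
apply: (le_trans (measureU2 _ _ _)) => //; first exact: bigsetU_measurable.
exact: leeD.
Qed.

(** * From bounded densities to rounded weights *)

Section DensityBound.
Variables (R : realType) (phi : R) (mu : probability R R).
Hypotheses (phi0 : 0 < phi) (Hmu : has_density_le phi mu).

Lemma density_itv (a b : R) : a <= b -> (mu `[a, b]%classic <= (phi * (b - a))%:E)%E.
Proof.
move=> ab; have [f [mf f0 ->//]] := Hmu.
have mA : measurable `[a, b]%classic by exact: measurable_itv.
apply: (@le_trans _ _ (\int[lebesgue_measure]_(x in `[a, b]%classic) (cst phi%:E) x)%E).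
  apply: ge0_le_integral => //=.
  - by move=> x _; rewrite lee_fin; have /andP[] := f0 x.
  - apply/measurable_EFinP; apply: measurable_funS mf => //; exact: measurableT.

  - by move=> x _; rewrite lee_fin; have /andP[] := f0 x.
rewrite integral_cst //= lebesgue_measure_itv /=.
case: ifP => _; first by rewrite EFinM EFinB.
by rewrite mule0 lee_fin mulr_ge0 ?subr_ge0 // ltW.
Qed.

(** All the mass lies on an interval of length 2. This later absorbs additive constants into
    multiples of [phi]. *)
Lemma density_ge_half : supported_on_unit mu -> 1 <= 2 * phi.
Proof.
rewrite /supported_on_unit => s1.
have := @density_itv (-1) 1 _; rewrite s1 lee_fin => /(_ _) h.
by have := h (ltac:(lra)); lra.
Qed.

End DensityBound.

Section SmallBall.
Variables (R : realType) (phi : R) (E : finType).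
Variables (D : E -> probability R R).
Variables (d : measure_display) (T : measurableType d) (P : probability T R).
Variable X : E -> {RV P >-> R}.
Hypothesis phi0 : 0 < phi.
Hypothesis Dsupp : forall e, supported_on_unit (D e).
Hypothesis Dphi : forall e, has_density_le phi (D e).
Hypothesis indep : mutually_independent X.
Hypothesis distr : forall e A, measurable A -> distribution P (X e) A = D e A.

Lemma P_preimage e (A : set R) : measurable A -> P (X e @^-1` A) = D e A.
Proof. by move=> mA; rewrite -distr. Qed.

Section Cells.
Variable M : nat.
Hypothesis M0 : (0 < M)%N.

(* The weights are rounded to cells of width 1/M, so that the independence of the
   X e is needed for finitely many boxes only. *)
Definition cell (j : 'I_(2 * M).+1) : set R :=
  `[-1 + j%:R / M%:R, -1 + j.+1%:R / M%:R[.

Lemma cell_measurable j : measurable (cell j).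
Proof. exact: measurable_itv. Qed.

Lemma cellP (x : R) j : cell j x <->
  j%:R <= M%:R * (x + 1) < j.+1%:R.
Proof.
have M0' : (0 : R) < M%:R by rewrite ltr0n.
rewrite /cell /= in_itv /= [M%:R * _]mulrC -ler_pdivrMr // -ltr_pdivlMr //.
by rewrite ![-1 + _]addrC lerBlDr ltrBrDr.
Qed.

(** The cells are half-open, so the endpoint 1 requires the last of the [(2 * M).+1] cells. *)
Lemma cell_exists (x : R) : -1 <= x <= 1 -> exists j, cell j x.
Proof.
move=> /andP[x1 x2]; have M0' : (0 : R) < M%:R by rewrite ltr0n.
have y0 : 0 <= M%:R * (x + 1) by apply: mulr_ge0; [exact: ltW|lra].
have := truncn_itv y0; set k := Num.truncn _ => /andP[h1 h2].
have kM : (k < (2 * M).+1)%N.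
  rewrite ltnS -(ler_nat R) (le_trans h1) // natrM mulrC; apply: ler_wpM2r; first exact: ltW.
  lra.
by exists (Ordinal kM); apply/cellP/andP.
Qed.

Lemma cell_uniq (x : R) j k : cell j x -> cell k x -> j = k.
Proof.
move=> /cellP/andP[h1 h2] /cellP/andP[h3 h4]; apply/val_inj => /=.
have jk : (j < k.+1)%N by rewrite -(ltr_nat R) (le_lt_trans h1 h4).
have kj : (k < j.+1)%N by rewrite -(ltr_nat R) (le_lt_trans h3 h2).
lia.
Qed.

Lemma cell_preimage_measurable e j : measurable (X e @^-1` cell j).
Proof. by apply: measurable_funPTI; exact: cell_measurable. Qed.

Definition mass e j : R := fine (P (X e @^-1` cell j)).

Lemma massE e j : P (X e @^-1` cell j) = (mass e j)%:E.
Proof.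
rewrite /mass fineK // fin_num_measure //; exact: cell_preimage_measurable.
Qed.

Lemma mass_ge0 e j : 0 <= mass e j.
Proof. exact/fine_ge0/measure_ge0. Qed.

Lemma mass_le e j : mass e j <= phi / M%:R.
Proof.
rewrite -lee_fin -massE P_preimage; last exact: cell_measurable.
have M0' : (0 : R) < M%:R by rewrite ltr0n.
have ab : -1 + j%:R / M%:R <= -1 + j.+1%:R / M%:R :> R.
  by rewrite lerD2l ler_pM2r ?invr_gt0 // ler_nat.
apply: (@le_trans _ _ (D e `[-1 + j%:R / M%:R, -1 + j.+1%:R / M%:R]%classic)).
  apply: le_measure; rewrite ?inE //; [exact: cell_measurable|].
  by move=> x; rewrite /cell /= !in_itv /= => /andP[-> /ltW].
apply: (le_trans (density_itv phi0 (Dphi e) ab)).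
rewrite lee_fin ler_pM2l // -addn1 natrD mulrDl mul1r; lra.
Qed.

Lemma sum_mass e : \sum_j mass e j = 1.
Proof.
have mc j : measurable (X e @^-1` cell j) by exact: cell_preimage_measurable.
have tc : trivIset setT (fun j => X e @^-1` cell j).
  by move=> j k _ _ [w [/= h1 h2]]; exact: cell_uniq h1 h2.
have mU : measurable (\big[setU/set0]_(j < (2 * M).+1) X e @^-1` cell j).
  exact: bigsetU_measurable.
apply/EFin_inj; rewrite -sumEFin.
under eq_bigr do rewrite -massE.
rewrite -(measure_semi_additive_ord P mc tc mU).
apply/eqP; rewrite eq_le probability_le1 //=.
rewrite -[X in (X <= _)%E](Dsupp e) -P_preimage; last exact: measurable_itv.
apply: le_measure; rewrite ?inE //; first by apply: measurable_funPTI; exact: measurable_itv.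
move=> w /=; rewrite in_itv /= => /cell_exists[j jw].
by rewrite -bigcup_mkord_ord; exists j => //=; rewrite ?ltn_ord // inord_val.
Qed.

End Cells.

Definition linear_form : Type := {ffun E -> int} * E.

Definition form_size (f : linear_form) : nat := (\sum_e `|f.1 e|)%N.

(** The constant term recentres the cell numbers, which start at -1. Each coordinate scaled by [M]
    is rounded by less than 1, so the total error is at most the sum of the absolute
    coefficients. *)
Lemma form_cells M (f : linear_form) (x : E -> R) (z : {ffun E -> 'I_(2 * M).+1}) (delta : R) n :
  (0 < M)%N -> (forall e, cell (z e) (x e)) -> (form_size f <= n)%N ->
  `|\sum_e (f.1 e)%:~R * x e| <= delta ->
  small (Num.truncn (M%:R * delta + n%:R)) (f, - (M%:Z * \sum_e f.1 e)) z.
Proof.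
move=> M0 Hz fn Hx; have M0' : (0 : R) < M%:R by rewrite ltr0n.
set K := \sum_e f.1 e * (z e)%:Z - M%:Z * \sum_e f.1 e.
rewrite /small /= -abszE lez_nat truncn_ge_nat; last first.
  by rewrite addr_ge0 // mulr_ge0 // (le_trans _ Hx).
rewrite natr_absz intr_norm.
have -> : K%:~R = M%:R * (\sum_e (f.1 e)%:~R * x e)
    - \sum_e (f.1 e)%:~R * (M%:R * (x e + 1) - (z e)%:R) :> R.
  rewrite /K intrB !rmorphM /= !rmorph_sum /= mulr_sumr -sumrB mulr_sumr -sumrB.
  by apply: eq_bigr => e _; rewrite rmorphM /= -!pmulrn; ring.
apply: le_trans (ler_normB _ _) _; apply: lerD.
  by rewrite normrM gtr0_norm // ler_wpM2l // ltW.
apply: (@le_trans _ _ (form_size f)%:R); last by rewrite ler_nat.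
apply: le_trans (ler_norm_sum _ _ _) _; rewrite /form_size natr_sum.
apply: ler_sum => e _; rewrite normrM natr_absz intr_norm.
rewrite -[leRHS]mulr1 ler_wpM2l //; have /(cellP M0) /andP[h1 h2] := Hz e.
rewrite ger0_norm ?subr_ge0 //; move: h2; rewrite -natr1; lra.
Qed.

Definition independent_forms (L : seq linear_form) :=
  all (fun f : linear_form => f.1 f.2 != 0) L && pairwise (fun f g : linear_form => g.1 f.2 == 0) L.

(** [B] is the finite union of the boxes of cells on which all rounded forms are small. *)
Lemma small_ball (delta : R) (L : seq linear_form) :
  0 < delta -> independent_forms L ->
  exists B : set T, [/\ measurable B, (P B <= ((3 * phi * delta) ^+ size L)%:E)%E
    & forall w, (forall e, -1 <= X e w <= 1) ->
      (forall f, f \in L -> `|\sum_e (f.1 e)%:~R * X e w| <= delta) -> B w].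
Proof.
move=> d0 /andP[L1 L2]; pose n := (\sum_(f <- L) form_size f)%N.
(* So fine that [2 * n + 1 <= M * delta]. Then [2 * t + 1 <= 3 * M * delta], and cells of mass at
   most [phi / M] give [3 * phi * delta] per form. *)
pose M := (Num.truncn ((2 * n%:R + 1) / delta)).+1.
have M0 : (0 < M)%N by [].
have Md : 2 * n%:R + 1 <= M%:R * delta.
  by rewrite -ler_pdivrMr // ltW // real_truncnS_gt // num_real.
have M0' : (0 : R) < M%:R by rewrite ltr0n.
pose q := phi / M%:R; pose t := Num.truncn (M%:R * delta + n%:R).
have q0 : 0 <= q by rewrite divr_ge0 // ltW.
pose L' : seq (form E) := [seq (f, - (M%:Z * \sum_e f.1 e)) | f : linear_form <- L].
have DB := @discrete_small_ball R E (2 * M).+1 (@mass M) q (@mass_ge0 M)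
  (@sum_mass M M0) (@mass_le M M0) q0 t L'.
pose F (z : {ffun E -> 'I_(2 * M).+1}) : set T :=
  \bigcap_(e in [set` [set: E]%SET]) (X e @^-1` cell (z e)).
have PF z : P (F z) = (weight (@mass M) z)%:E.
  rewrite /F (indep [set: E]%SET (B := fun e => cell (z e))); last by move=> e; exact: cell_measurable.
  rewrite /weight -prodEFin big_mkcond /=; apply: eq_bigr => e _.
  by rewrite finset.in_setT massE.
have mF z : measurable (F z).
  by apply: fin_bigcap_measurable => // e _; exact: cell_preimage_measurable.
exists (\big[setU/set0]_(z | all (small t ^~ z) L') F z); split.
- exact: bigsetU_measurable.
- apply: le_trans (union_bound _ _ _ mF) _.
  under eq_bigr do rewrite PF.
  rewrite sumEFin lee_fin; apply: le_trans (DB _ _) _.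
  + by rewrite all_map.
  + by rewrite pairwise_map.
  rewrite size_map; apply: lerXn2r; rewrite ?nnegrE.
  + by rewrite mulr_ge0.
  + by rewrite !mulr_ge0 // ltW.
  rewrite /q mulrCA [3 * phi]mulrC -[leRHS]mulrA ler_pM2l // ler_pdivrMr //.
  have : (t%:R : R) <= M%:R * delta + n%:R.
    by rewrite truncn_le addr_ge0 // mulr_ge0 // ltW.
  rewrite -natr1 natrM; lra.
move=> w wX wL.
have /fin_all_exists [z0 Hz] : forall e, exists j : 'I_(2 * M).+1, cell j (X e w).
  by move=> e; apply: cell_exists => //.
pose z : {ffun E -> 'I_(2 * M).+1} := [ffun e => z0 e].
have zL : all (small t ^~ z) L'.
  apply/allP => _ /mapP[f fL ->]; apply: form_cells (wL f fL) => //.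
    by move=> e; rewrite ffunE.
  by rewrite /n (big_rem f) //= leq_addr.
rewrite (bigD1 z) //=; left => e _ /=; rewrite ffunE; exact: Hz.
Qed.

End SmallBall.

(** * Steps of small improvement *)

Section Cut.
Variables (R : realType) (n : nat).
Notation V := ('I_n.*2).
Implicit Types (e : edge n) (A : {set V}) (p : node_partition n).

Definition cuts A e := #|val e :&: A| == 1%N.

Lemma crossing_cuts p e : balanced p -> crossing p e = cuts p.1 e.
Proof.
case/and3P => /eqP p2 _ _; rewrite /crossing p2 /cuts -finset.setDE.
have := cardsID p.1 (val e); rewrite (eqP (valP e)).
by case: eqP => [->|_] //; rewrite add1n => -[->].
Qed.

Lemma edgeP e : exists x y, x != y /\ val e = [set x; y]%SET.
Proof. by have /cards2P[x [y [xy ->]]] := valP e; exists x, y. Qed.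

Lemma cuts_pair A e x y : x != y -> val e = [set x; y]%SET ->
  cuts A e = (x \in A) (+) (y \in A).
Proof.
move=> xy; rewrite /cuts => ->; rewrite (cardsD1 x) (cardsD1 y) !inE !eqxx orbT /=.
rewrite [y == x]eq_sym (negbTE xy) /=.
rewrite [X in (_ + (_ + X))%N](_ : _ = 0%N); first by case: (x \in A); case: (y \in A).
apply/eqP; rewrite cards_eq0; apply/eqP/setP => z; rewrite !inE.
by case: (z == y); case: (z == x); rewrite ?andbF.
Qed.

Lemma balanced_exchange p u v : balanced p -> u \in p.1 -> v \in p.2 ->
  balanced (exchange p u v).
Proof.
case/and3P => /eqP p2 c1 c2 u1 v2; rewrite /balanced /=.
have uv : v \notin p.1 by move: v2; rewrite p2 inE.
apply/and3P; split.
- apply/eqP/setP => z; rewrite p2 !inE.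
  have nuv : u != v by apply: contraNneq uv => <-.
  have [->|_] := eqVneq z u; first by rewrite (negbTE nuv).
  by have [->|_] := eqVneq z v.
- apply/eqP; rewrite -[RHS](eqP c1) [RHS](cardsD1 u) u1 cardsU1.
  by rewrite !inE (negbTE uv) andbF.
apply/eqP; rewrite -[RHS](eqP c2) [RHS](cardsD1 v) v2 cardsU1 p2.
by rewrite !inE u1 andbF.
Qed.

Definition cut_response l (U : nat -> {set V}) (c : {ffun 'I_l -> int}) :
    {ffun edge n -> int} :=
  [ffun e => \sum_t c t * ((cuts (U t) e)%:R - (cuts (U t.+1) e)%:R)].

Lemma cut_responseE l U (c : {ffun 'I_l -> int}) e x y :
  x != y -> val e = [set x; y]%SET -> cut_response U c e = response U c x y.
Proof.
move=> xy ee; rewrite ffunE /response; apply: eq_bigr => t _.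
by rewrite /gain !(cuts_pair _ xy ee).
Qed.

Lemma cut_weight_sum (w : edge n -> R) p : balanced p ->
  cut_weight w p = \sum_e (cuts p.1 e)%:R * w e.
Proof.
move=> bp; rewrite /cut_weight big_mkcond; apply: eq_bigr => e _.
by rewrite (crossing_cuts _ bp); case: (cuts _ _); rewrite ?mul1r ?mul0r.
Qed.

Lemma cut_response_sum l (w : edge n -> R) (p : nat -> node_partition n)
    (c : {ffun 'I_l -> int}) : (forall t, (t <= l)%N -> balanced (p t)) ->
  \sum_(t < l) (c t)%:~R * (cut_weight w (p t) - cut_weight w (p t.+1)) =
  \sum_e (cut_response (fun t => (p t).1) c e)%:~R * w e.
Proof.
move=> bp.
under eq_bigr => t _.
  rewrite !cut_weight_sum ?bp ?ltn_ord ?(ltnW (ltn_ord t)) // -sumrB mulr_sumr.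
  over.
rewrite exchange_big /=; apply: eq_bigr => e _.
rewrite ffunE rmorph_sum mulr_suml; apply: eq_bigr => t _.
by rewrite rmorphM rmorphB /= !rmorph_nat -mulrBl mulrA.
Qed.

Lemma cut_weight_le (w : edge n -> R) p : (forall e, -1 <= w e <= 1) ->
  `|cut_weight w p| <= #|{: edge n}|%:R.
Proof.
move=> hw; apply: le_trans (ler_norm_sum _ _ _) _.
apply: (@le_trans _ _ (\sum_(e : edge n) 1)); last by rewrite sumr_const.
rewrite big_mkcond; apply: ler_sum => e _; case: ifP => // _.
by rewrite ler_norml.
Qed.

Lemma card_edge : (#|{: edge n}| <= (2 * n) ^ 2)%N.
Proof.
rewrite card_sig (eq_card (B := [set A : {set V} | #|A| == 2%N]%SET)); last first.
  by move=> A; rewrite !inE.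
rewrite card_draws card_ord bin2 -mul2n; lia.
Qed.

Definition descent (w : edge n -> R) (eps : R) (p : nat -> node_partition n)
    (mv : nat -> V * V) l := forall t, (t < l)%N ->
  [/\ balanced (p t), (mv t).1 \in (p t).1, (mv t).2 \in (p t).2,
      p t.+1 = exchange (p t) (mv t).1 (mv t).2
    & 0 < cut_weight w (p t) - cut_weight w (p t.+1) <= eps].

Definition firsts (p : nat -> node_partition n) t : {set V} := (p t).1.

Lemma descent_swap (w : edge n -> R) (eps : R) (p : nat -> node_partition n) mv l : descent w eps p mv l -> swap_seq mv (firsts p) l.
Proof.
move=> H t /H[/and3P[/eqP p2 _ _] h1 h2 h3 _]; rewrite /firsts h3; split=> //.
by move: h2; rewrite p2 inE.
Qed.

Lemma descent_balanced (w : edge n -> R) (eps : R) (p : nat -> node_partition n) mv l t : (0 < l)%N -> descent w eps p mv l ->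
  (t <= l)%N -> balanced (p t).
Proof.
move=> l0 H; case: t => [|t] tl; first by have [] := H 0%N l0.
by have [bt h1 h2 -> _] := H t tl; exact: balanced_exchange.
Qed.

Lemma probe_sum_le (w : edge n -> R) (eps : R) (p : nat -> node_partition n) mv l (c : {ffun 'I_l -> int}) : (0 < l)%N ->
  descent w eps p mv l ->
  `|\sum_e (cut_response (firsts p) c e)%:~R * w e| <= (norm1 c)%:R * eps.
Proof.
move=> l0 H; rewrite -cut_response_sum; last by move=> t; exact: descent_balanced l0 H.
apply: le_trans (ler_norm_sum _ _ _) _; rewrite /norm1 natr_sum mulr_suml.
apply: ler_sum => t _; rewrite normrM natr_absz intr_norm ler_wpM2l //.
by have [_ _ _ _ /andP[h1 h2]] := H t (ltn_ord t); rewrite gtr0_norm.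
Qed.

Definition rich (A : nat) mv (p : nat -> node_partition n) l := exists L : seq (probe V l),
  [/\ all (@good_probe V mv (firsts p) l) L, triangular (firsts p) L & (l <= A * size L)%N].

Lemma norm1_probe mv U l (q : probe V l) : good_probe mv U q -> (norm1 q.1.1 <= 4 * n + 2)%N.
Proof.
by case/and4P => _ h _ _; apply: leq_trans h _; rewrite leq_add2r card_ord -mul2n mulnA.
Qed.

End Cut.

Section BadEvents.
Variables (R : realType) (n : nat) (phi : R).
Notation V := ('I_n.*2).
Variables (D : edge n -> probability R R).
Variables (d : measure_display) (T : measurableType d) (P : probability T R).
Variable X : edge n -> {RV P >-> R}.
Hypothesis phi0 : 0 < phi.
Hypothesis Dsupp : forall e, supported_on_unit (D e).
Hypothesis Dphi : forall e, has_density_le phi (D e).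
Hypothesis indep : mutually_independent X.
Hypothesis distr : forall e A, measurable A -> distribution P (X e) A = D e A.

Lemma swap_seq_ext (mv mv' : nat -> V * V) U l : (forall t, (t < l)%N -> mv t = mv' t) ->
  swap_seq mv U l -> swap_seq mv' U l.
Proof. by move=> E H t tl; rewrite -E //; exact: H. Qed.

Lemma bad_window A l (m : {ffun 'I_l -> V * V}) (eps beta : R) : (0 < l)%N ->
  0 < eps -> 0 <= beta -> (forall k, (l <= A * k)%N -> (3 * phi * ((4 * n + 2)%:R * eps)) ^+ k <= beta) ->
  exists B : set T, [/\ measurable B, (P B <= beta%:E)%E
    & forall w, (forall e, -1 <= X e w <= 1) -> forall (p : nat -> node_partition n) (mv : nat -> V * V),
      (forall t : 'I_l, mv t = m t) -> descent (X ^~ w) eps p mv l -> rich A mv p l -> B w].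
Proof.
move=> l0 eps0 beta0 Hb.
(* If the moves [m] are ever realized by a rich descent, the probes of one realization serve for all
   others, since circulations respond alike by [response_moves]; otherwise the empty event
   suffices. *)
have [[p [mv [mvm [[w [eps' dw]] [L [gL tL sL]]]]]]|no] := pselect (exists (p : nat -> node_partition n) (mv : nat -> V * V),
    (forall t : 'I_l, mv t = m t) /\
    (exists w eps', descent (X ^~ w) eps' p mv l) /\ rich A mv p l); last first.
  exists set0; split => //; first by rewrite measure0 lee_fin.
  by move=> w _ p mv h1 h2 h3; case: no; exists p, mv; do 2?split => //; exists w, eps.
have HU := descent_swap dw.
(* A default for [insubd]: as [0 < l], richness forces a probe, whose pivot pair is an edge. *)
have [e0 _] : exists e0 : edge n, True.
  case: L gL sL {tL} => [_|q L /= /andP[/and4P[_ _ xy _] _] _]; first by rewrite muln0 leqNgt l0.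
  have c2 : #|[set q.1.2; q.2]%SET| == 2%N by rewrite cards2 xy.
  by exists (exist (fun e : {set V} => #|e| == 2%N) _ c2).
pose fm (q : probe V l) : linear_form (edge n) :=
  (cut_response (firsts p) q.1.1, insubd e0 [set q.1.2; q.2]%SET).
have fmE q : q.1.2 != q.2 -> val (fm q).2 = [set q.1.2; q.2]%SET.
  by move=> xy; rewrite /fm insubdK // unfold_in cards2 xy.
have [||B [mB PB HB]] := small_ball phi0 Dsupp Dphi indep distr
    (delta := (4 * n + 2)%:R * eps) (L := map fm L).
- by rewrite mulr_gt0 // ltr0n addn2.
- apply/andP; split.
    rewrite all_map; apply: sub_all gL => q /and4P[_ _ xy r] /=.
    by rewrite (cut_responseE _ _ xy (fmE q xy)).
  rewrite pairwise_map; move: tL gL; rewrite /triangular; elim: (L) => //= q L' IH.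
  move=> /andP[a1 a2] /andP[/and4P[_ _ xy _] g2]; rewrite IH // andbT.
  by apply: sub_all a1 => q' /=; rewrite (cut_responseE _ _ xy (fmE q xy)).
exists B; split => //.
  by apply: le_trans PB _; rewrite lee_fin size_map Hb.
move=> w' Xw p' mv' mvm' dw' _; apply: HB => // _ /mapP[q qL ->].
have E t : (t < l)%N -> mv t = mv' t.
  by move=> tl; rewrite (mvm (Ordinal tl)) (mvm' (Ordinal tl)).
have HU' := swap_seq_ext (fun t tl => esym (E t tl)) (descent_swap dw').
have gq := allP gL q qL.
have -> : \sum_e ((fm q).1 e)%:~R * X e w' =
    \sum_e (cut_response (firsts p') q.1.1 e)%:~R * X e w'.
  apply: eq_bigr => e _; congr (_%:~R * _).
  have [x [y [xy ee]]] := edgeP e; rewrite !(cut_responseE _ _ xy ee).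
  by apply: (response_moves _ _ HU HU'); case/and4P: gq.
apply: le_trans (probe_sum_le _ l0 dw') _.
by rewrite ler_wpM2r ?ler_nat ?(norm1_probe gq) // ltW.
Qed.

End BadEvents.

(** * Termination when no window of small improvements is rich *)

Section Termination.
Variables (R : realType) (n : nat) (w : edge n -> R).
Notation V := ('I_n.*2).

Definition no_rich (A h : nat) (eps : R) := forall i, (i <= h)%N ->
  forall (p : nat -> node_partition n) (mv : nat -> V * V),
  descent w eps p mv (2 ^ i) -> ~ rich A mv p (2 ^ i).

Lemma descent_shift (p : nat -> node_partition n) (mv : nat -> V * V) (eps : R) l s l' :
  (s + l' <= l)%N -> descent w eps p mv l ->
  descent w eps (fun t => p (s + t)%N) (fun t => mv (s + t)%N) l'.
Proof.
by move=> sl H t tl; rewrite addnS; apply: H; apply: leq_trans sl; rewrite ltn_add2l.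
Qed.

Lemma descent_decr (p : nat -> node_partition n) (mv : nat -> V * V) (eps : R) l t t' :
  descent w eps p mv l -> (t < t')%N -> (t' <= l)%N ->
  cut_weight w (p t') < cut_weight w (p t).
Proof.
move=> H; elim: t' => // t' IH tt' tl'.
have [_ _ _ _ /andP[h _]] := H t' tl'; rewrite subr_gt0 in h.
move: tt'; rewrite ltnS leq_eqVlt => /orP[/eqP-> //|tt'].
by apply: lt_trans h _; apply: IH => //; exact: ltnW.
Qed.

Lemma descent_firsts_inj (p : nat -> node_partition n) (mv : nat -> V * V) (eps : R) l t t' :
  (0 < l)%N -> descent w eps p mv l -> (t <= l)%N -> (t' <= l)%N ->
  firsts p t = firsts p t' -> t = t'.
Proof.
move=> l0 H tl tl' E.
have Ep : p t = p t'.
  have /and3P[/eqP e1 _ _] := descent_balanced l0 H tl.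
  have /and3P[/eqP e2 _ _] := descent_balanced l0 H tl'.
  move: E e1 e2; rewrite /firsts; case: (p t) => a b; case: (p t') => a' b' /=.
  by move=> -> -> ->.
case: (ltngtP t t') => // tt'.
  by have := descent_decr H tt' tl'; rewrite Ep ltxx.
by have := descent_decr H tt' tl; rewrite Ep ltxx.
Qed.

Variables (r K h : nat).
Hypotheses (r162 : (162 <= r)%N) (rK : (3 ^ r <= K)%N) (h0 : (0 < h)%N).
Hypothesis nh : (2 * n.*2 * (16 * K * h) <= 2 ^ h)%N.

Lemma no_long_descent (p : nat -> node_partition n) (mv : nat -> V * V) (eps : R) :
  no_rich (256 * K * h ^ 2) h eps -> ~ descent w eps p mv (2 ^ h).
Proof.
move=> nr H; have l0 : (0 < 2 ^ h)%N by rewrite expn_gt0.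
have nh' : (2 * #|V| * (16 * K * h) <= 2 ^ h)%N by rewrite card_ord.
have [i [s [L [ih sl sL gL tL]]]] := rich_window r162 rK h0 nh' (descent_swap H)
  (fun t t' => @descent_firsts_inj p mv eps (2 ^ h) t t' l0 H).
by apply: (nr i ih _ _ (descent_shift sl H)); exists L; split.
Qed.

(** Otherwise the run makes [J] blocks of [2 ^ h] swaps. Each block contains an improvement above
    [eps] by [no_long_descent], so the total exceeds twice the number of edges, whereas cut weights
    are bounded by that number in absolute value. *)
Lemma swap_terminates (eps : R) J : (forall e, -1 <= w e <= 1) -> 0 < eps ->
  no_rich (256 * K * h ^ 2) h eps -> 2 * #|{: edge n}|%:R < J%:R * eps ->
  every_swap_terminates_within w (2 ^ h * J)%:R.
Proof.
move=> w1 eps0 nr HJ p0 rule bp0 impl; set N := (2 ^ h)%N.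
pose run k := swap_run rule p0 k.
case: (boolP [exists k : 'I_(N * J), ~~ isSome (rule (run k).1 (run k).2)]).
  move=> /existsP[k]; case E: (rule _ _) => [//|] _.
  by exists k; split => //; rewrite ler_nat ltnW.
rewrite negb_exists => /forallP HS; exfalso.
have J0 : (0 < J)%N.
  by case: J HJ {HS} => //; rewrite mul0r ltNge mulr_ge0.
have NJ0 : (0 < N * J)%N by rewrite muln_gt0 J0 expn_gt0.
(* A default for [odflt], taken from the first swap because the type of nodes may be empty. *)
have u0 : V.
  by have := HS (Ordinal NJ0); case: (rule _ _) => [[u v] _|//]; exact: u.
pose p k := (run k).2.
pose mv k := odflt (u0, u0) (rule (run k).1 (run k).2).
have step k : (k < N * J)%N -> balanced (p k) ->
    improving w (p k) (mv k).1 (mv k).2 /\ p k.+1 = exchange (p k) (mv k).1 (mv k).2.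
  move=> kN bk; have := HS (Ordinal kN); have := impl (run k).1 (run k).2 bk.
  rewrite /p /mv /run /swap_run iterS /swap_step /=.
  by case: (iter k _ _) => hh q /=; case: (rule hh q) => [[u v]|].
have bal k : (k <= N * J)%N -> balanced (p k).
  elim: k => [|k IH] kN //; have bk := IH (ltnW kN).
  have [/and3P[h1 h2 _] ->] := step k kN bk; exact: balanced_exchange.
pose drop k := cut_weight w (p k) - cut_weight w (p k.+1).
have drop0 k : (k < N * J)%N -> 0 < drop k.
  move=> kN; have [/and3P[_ _ h3] e] := step k kN (bal k (ltnW kN)).
  by rewrite /drop e subr_gt0.
have block j : (j < J)%N -> exists2 t, (t < N)%N & eps < drop (j * N + t)%N.
  move=> jJ; have jN t : (t < N)%N -> (j * N + t < N * J)%N.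
    move=> tN; apply: (@leq_trans (j.+1 * N)); first by rewrite mulSnr ltn_add2l.
    by rewrite mulnC leq_mul2l jJ orbT.
  case: (boolP [exists t : 'I_N, eps < drop (j * N + t)%N]) => [/existsP[t ht]|].
    by exists t.
  rewrite negb_exists => /forallP Hd; exfalso.
  apply: (@no_long_descent (fun t => p (j * N + t)%N) (fun t => mv (j * N + t)%N) _ nr).
  move=> t tN; have tJ := jN t tN; have [/and3P[h1 h2 _] e] := step _ tJ (bal _ (ltnW tJ)).
  rewrite addnS; split => //; first exact: bal (ltnW tJ).
  rewrite -/(drop _) drop0 //=.
  by have := Hd (Ordinal tN); rewrite -leNgt.
have decr s t : (s + t <= N * J)%N -> cut_weight w (p (s + t)%N) <= cut_weight w (p s).
  elim: t => [|t IH] st; first by rewrite addn0.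
  rewrite addnS in st *; apply: le_trans (IH (ltnW st)).
  by have := drop0 _ st; rewrite subr_gt0 => /ltW.
have total j : (j <= J)%N -> j%:R * eps <= cut_weight w (p 0%N) - cut_weight w (p (j * N)%N).
  elim: j => [|j IH] jJ; first by rewrite mul0r mul0n subrr.
  have [t tN ht] := block j jJ; have := IH (ltnW jJ).
  have jN : (j.+1 * N <= N * J)%N by rewrite mulnC leq_mul2l jJ orbT.
  have e1 : ((j * N + t).+1 + (N - t.+1) = j.+1 * N)%N by rewrite mulSnr; lia.
  have := decr (j * N + t).+1%N (N - t.+1)%N; rewrite e1 => /(_ jN) d1.
  have e2 : (j * N + t <= N * J)%N by apply: leq_trans jN; rewrite mulSnr leq_add2l ltnW.
  have d2 := decr (j * N)%N t e2.
  move: ht; rewrite /drop -natr1 mulrDl mul1r; lra.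

have := total J (leqnn J).
have := cut_weight_le (p 0%N) w1; have := cut_weight_le (p (J * N)%N) w1.
rewrite !ler_norml => /andP[a1 a2] /andP[b1 b2] c.
lra.
Qed.

End Termination.

(** * Measurability of the termination event *)

Section Measurability.
Variables (R : realType) (n : nat).
Variables (d : measure_display) (T : measurableType d) (P : probability T R).
Variable X : edge n -> {RV P >-> R}.
Let pair := (node_partition n * node_partition n)%type.

(** The algorithm sees the weights only through these comparisons; there are finitely many tables,
    so the event is a finite union of their fibres. *)
Let table w : {ffun pair -> bool} :=
  [ffun q => cut_weight (X ^~ w) q.1 < cut_weight (X ^~ w) q.2].

Lemma measurable_cut p : measurable_fun setT (fun w => cut_weight (X ^~ w) p).
Proof.
rewrite /cut_weight; under eq_fun do rewrite big_mkcond.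
by apply: measurable_sum => e; case: crossing => //; exact: measurable_funP.
Qed.

Lemma measurable_table (tau : {ffun pair -> bool}) : measurable [set w | table w = tau].
Proof.
have -> : [set w | table w = tau] = \bigcap_(q in [set: pair])
    (fun w => cut_weight (X ^~ w) q.1 < cut_weight (X ^~ w) q.2) @^-1` [set tau q].
  apply/seteqP; split => w /=; first by move=> <- q _ /=; rewrite ffunE.
  by move=> H; apply/ffunP => q; rewrite ffunE; exact: H.
apply: fin_bigcap_measurable => [|q _]; [exact: finite_finset|rewrite -[X in measurable X]setTI].
by apply: measurable_fun_ltr => //; exact: measurable_cut.
Qed.

Lemma table_terminates B w w' : table w = table w' ->
  every_swap_terminates_within (X ^~ w) B -> every_swap_terminates_within (X ^~ w') B.
Proof.
move=> E H p0 rule b0 impl; apply: H => // h p bp; have := impl h p bp.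
have I u v : improving (X ^~ w') p u v = improving (X ^~ w) p u v.
  by rewrite /improving; have /ffunP /(_ (exchange p u v, p)) := E; rewrite !ffunE => ->.
by case: (rule h p) => [[u v]|]; [rewrite I|move=> hh u v; rewrite -I].
Qed.

Lemma measurable_terminates B :
  measurable [set w | every_swap_terminates_within (X ^~ w) B].
Proof.
have -> : [set w | every_swap_terminates_within (X ^~ w) B] =
    \bigcup_(tau in [set tau | exists w, table w = tau /\
       every_swap_terminates_within (X ^~ w) B]) [set w | table w = tau].
  apply/seteqP; split => w /=; first by move=> H; exists (table w) => //; exists w.
  by move=> [_ [w' [<- H]] E]; exact: table_terminates H.
by apply: fin_bigcup_measurable => [|tau _]; [exact: finite_finset|exact: measurable_table].
Qed.

End Measurability.

Section BadEvent.
Variables (R : realType) (n : nat) (phi : R).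
Notation V := ('I_n.*2).
Variables (D : edge n -> probability R R).
Variables (d : measure_display) (T : measurableType d) (P : probability T R).
Variable X : edge n -> {RV P >-> R}.
Hypothesis n0 : (0 < n)%N.
Hypothesis phi0 : 0 < phi.
Hypothesis Dsupp : forall e, supported_on_unit (D e).
Hypothesis Dphi : forall e, has_density_le phi (D e).
Hypothesis indep : mutually_independent X.
Hypothesis distr : forall e A, measurable A -> distribution P (X e) A = D e A.
Variables (A h : nat) (eps : R).
Let b : R := n.*2%:R.
Hypothesis epsE : 3 * phi * ((4 * n + 2)%:R * eps) = (b ^+ (4 * A))^-1.

Lemma base_ge1 : 1 <= b.
Proof. by rewrite /b -[1]/(1%:R) ler_nat; lia. Qed.

Lemma eps_gt0 : 0 < eps.
Proof.
have : 0 < 3 * phi * ((4 * n + 2)%:R * eps).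
  by rewrite epsE invr_gt0 exprn_gt0 // (lt_le_trans _ base_ge1).
have c1 : 0 < 3 * phi by rewrite mulr_gt0.
have c2 : (0 : R) < (4 * n + 2)%:R by rewrite ltr0n addn2.
by rewrite (pmulr_rgt0 _ c1) (pmulr_rgt0 _ c2).
Qed.

Lemma window_bound l k : (l <= A * k)%N ->
  (3 * phi * ((4 * n + 2)%:R * eps)) ^+ k <= (b ^+ (4 * l))^-1.
Proof.
move=> lk; have b0 : 0 < b := lt_le_trans ltr01 base_ge1.
rewrite epsE exprVn -exprM lef_pV2 ?posrE ?exprn_gt0 //.
by rewrite ler_weXn2l ?base_ge1 // -mulnA leq_mul2l lk orbT.
Qed.

(** There are [b ^+ (2 * l)] sequences of [l] swaps, each bad with probability at most
    [b ^- (4 * l)] by the choice of [eps]. *)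
Lemma bad_scale l : (0 < l)%N ->
  exists B : set T, [/\ measurable B, (P B <= (b ^- 2)%:E)%E
    & forall w, (forall e, -1 <= X e w <= 1) ->
      forall (p : nat -> node_partition n) (mv : nat -> V * V),
      descent (X ^~ w) eps p mv l -> ~ B w -> ~ rich A mv p l].
Proof.
move=> l0; have b0 : 0 < b := lt_le_trans ltr01 base_ge1.
have beta0 : 0 <= (b ^+ (4 * l))^-1 by rewrite invr_ge0 exprn_ge0 // ltW.
have /choice [F HF] := fun m : {ffun 'I_l -> V * V} =>
  bad_window phi0 Dsupp Dphi indep distr m l0 eps_gt0 beta0 (@window_bound l).
exists (\big[setU/set0]_m F m); split.
- by apply: bigsetU_measurable => m _; case: (HF m).
- apply: (@le_trans _ _ (\sum_m P (F m))%E).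
    by apply: union_bound => m; case: (HF m).
  apply: (@le_trans _ _ (\sum_(m : {ffun 'I_l -> V * V}) (b ^+ (4 * l))^-1%:E)%E).
    by apply: lee_sum => m _; case: (HF m).
  rewrite sumEFin lee_fin sumr_const card_ffun card_prod !card_ord -[_ *+ _]mulr_natl.
  rewrite natrX natrM -/b -expr2 -exprM.
  have -> : (4 * l = 2 * l + 2 * l)%N by lia.
  rewrite exprD invfM mulrA divff ?gt_eqF ?exprn_gt0 // mul1r.
  by rewrite lef_pV2 ?posrE ?exprn_gt0 // ler_weXn2l ?base_ge1 //; lia.
move=> w wX p mv H nB rh; apply: nB.
pose m : {ffun 'I_l -> V * V} := [ffun t : 'I_l => mv t].
have [_ _ Hm] := HF m; rewrite (bigD1 m) //=; left.
by apply: (Hm w wX p mv _ H rh) => t; rewrite ffunE.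
Qed.

Lemma bad_event : exists B : set T, [/\ measurable B, (P B <= (h.+1%:R / b ^+ 2)%:E)%E
  & forall w, (forall e, -1 <= X e w <= 1) -> ~ B w -> no_rich (X ^~ w) A h eps].
Proof.
have /choice [F HF] := fun i : 'I_h.+1 => bad_scale (l := 2 ^ i) (expn_gt0 2 i).
exists (\big[setU/set0]_i F i); split.
- by apply: bigsetU_measurable => i _; case: (HF i).
- apply: (@le_trans _ _ (\sum_i P (F i))%E).
    by apply: union_bound => i; case: (HF i).
  apply: (@le_trans _ _ (\sum_(i < h.+1) (b ^- 2)%:E)%E).
    by apply: lee_sum => i _; case: (HF i).
  by rewrite sumEFin lee_fin sumr_const card_ord -[_ *+ _]mulr_natl.
move=> w wX nB i ih p mv H; have [_ _ Hi] := HF (Ordinal (ih : (i < h.+1)%N)).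
apply: (Hi w wX p mv H) => Bi; apply: nB.
by rewrite (bigD1 (Ordinal (ih : (i < h.+1)%N))) //=; left.
Qed.

(** The supports confine the weights to [[-1, 1]] only almost surely, so the pointwise arguments are
    restricted to this event. *)
Definition in_range := \bigcap_(e in [set: edge n]) (X e @^-1` `[-1, 1]).

Lemma in_range_measurable : measurable in_range.
Proof.
apply: fin_bigcap_measurable => [|e _]; first exact: finite_finset.
by apply: measurable_funPTI; exact: measurable_itv.
Qed.

Lemma in_range_full : P (~` in_range) = 0%E.
Proof.
have mF e : measurable (X e @^-1` `[-1, 1]).
  by apply: measurable_funPTI; exact: measurable_itv.
apply/eqP; rewrite eq_le measure_ge0 andbT.
pose F e := ~` (X e @^-1` `[-1, 1]).
apply: (@le_trans _ _ (\sum_e P (F e))%E); last first.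
  rewrite big1 // => e _; rewrite probability_setC //.
  rewrite [X in (_ - X)%E](_ : _ = 1%E) ?subee //.
  rewrite -[RHS](Dsupp e) -(distr e) //; exact: measurable_itv.
apply: le_trans (union_bound P _ _ (fun e => measurableC (mF e))).
apply: le_measure; rewrite ?inE.
- exact/measurableC/in_range_measurable.
- by apply: bigsetU_measurable => e _; exact: measurableC.
rewrite /in_range setC_bigcap => w [e _ He].
by rewrite (bigD1 e) //=; left.
Qed.

End BadEvent.

(** * Constants *)

Lemma exp2_dominates (a : nat) : exists c, (a * (c + 2) <= 2 ^ c)%N.
Proof.
exists (2 * a + 4)%N; rewrite expnD mul2n -addnn expnD.
have h : (a < 2 ^ a)%N by apply: ltn_expl.
have := leq_mul h h; rewrite (_ : 2 ^ 4 = 16)%N //; nia.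
Qed.

(** Twice the binary logarithm of [n] makes the run longer than [2 ^ c * n ^ 2], which beats a fixed
    multiple of [n * log n] for large [c]. *)
Definition run_scale c n := (2 * (trunc_log 2 n).+1 + c)%N.

Section Scale.
Variables (K c n : nat).
Hypotheses (n0 : (0 < n)%N) (cK : (64 * K * (c + 2) <= 2 ^ c)%N).

(** Both [n] and [L] are at most [Q = 2 ^ L], so [n * run_scale c n] is at most [(c + 2) * Q ^ 2],
    while [2 ^ run_scale c n = 2 ^ c * Q ^ 2]. *)
Lemma run_scale_big : (2 * n.*2 * (16 * K * run_scale c n) <= 2 ^ run_scale c n)%N.
Proof.
have := trunc_log_ltn n (isT : (1 < 2)%N); rewrite /run_scale; set L := (trunc_log 2 n).+1 => nL.
have -> : (2 ^ (2 * L + c) = 2 ^ c * (2 ^ L * 2 ^ L))%N by rewrite expnD mul2n -addnn expnD mulnC.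
have LL : (L < 2 ^ L)%N by apply: ltn_expl.
set Q := (2 ^ L)%N in nL LL *.
have h1 : (2 * L + c <= (c + 2) * Q)%N.
  have : (c <= c * Q)%N by rewrite leq_pmulr //; lia.
  by rewrite mulnDl; lia.
have h2 : (n * (2 * L + c) <= Q * ((c + 2) * Q))%N by rewrite leq_mul // ltnW.
have h3 := leq_mul cK (leqnn (Q * Q)).
have h4 := leq_mul (leqnn (64 * K)) h2.
apply: leq_trans h3; rewrite -mul2n.
have -> : (2 * (2 * n) * (16 * K * (2 * L + c)) = 64 * K * (n * (2 * L + c)))%N by ring.
by apply: (leq_trans h4); rewrite leq_eqVlt; apply/orP; left; apply/eqP; ring.
Qed.

Lemma run_scale_le : (run_scale c n <= (c + 2) * n)%N.
Proof.
have := trunc_logP (isT : (1 < 2)%N) n0; rewrite /run_scale => nL.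
have := ltn_expl (trunc_log 2 n) (isT : (1 < 2)%N) => LL.
have : (c <= c * n)%N by rewrite leq_pmulr.
rewrite mulnDl; lia.
Qed.

Lemma run_scale_ln (R : realType) : 1 <= ln n%:R :> R ->
  (run_scale c n)%:R <= (2 / ln 2 + 2 + c%:R) * ln n%:R :> R.
Proof.
move=> ln1; have l2 : 0 < ln 2 :> R by rewrite ln_gt0 // ltr1n.
have nL := trunc_logP (isT : (1 < 2)%N) n0.
have h1 : (trunc_log 2 n)%:R * ln 2 <= ln n%:R :> R.
  rewrite mulr_natl -lnXn; last by rewrite ltr0n.
  by rewrite -natrX ler_ln ?posrE ?ltr0n ?expn_gt0 // ler_nat.
have h2 : (trunc_log 2 n)%:R <= ln n%:R / ln 2 :> R by rewrite ler_pdivlMr.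
have h3 : 0 <= c%:R :> R by [].
rewrite /run_scale natrD natrM -natr1 !mulrDl mulrAC -mulrA.
have := ler_wpM2l h3 ln1; rewrite mulr1; lra.
Qed.

End Scale.

(** The number of blocks is at most [18 * phi * b ^+ (4 * A + 3)] before rounding, and
    [1 <= 2 * phi] pays for the rounding. The rest is [20 <= b ^+ 5], [2 ^ h <= b ^+ h] and
    [b <= n ^ 2]. *)
Lemma step_bound (R : realType) (n h A m : nat) (phi eps : R) :
  (1 < n)%N -> 1 <= 2 * phi -> 0 < eps -> (m <= (2 * n) ^ 2)%N ->
  3 * phi * ((4 * n + 2)%:R * eps) = (n.*2%:R ^+ (4 * A))^-1 ->
  (2 ^ h * (Num.truncn (2 * m%:R / eps)).+1)%:R <= phi * n%:R ^+ (2 * (4 * A + 8 + h)).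
Proof.
set b : R := n.*2%:R => n2 phi1 eps0 mn epsE; have phi0 : 0 < phi by lra.
have b2 : 2 <= b by rewrite /b ler_nat; lia.
have b0 : 0 < b by lra.
have b1 : 1 <= b by lra.
have ie : eps^-1 = 3 * phi * (4 * n + 2)%:R * b ^+ (4 * A).
  apply: (mulIf (lt0r_neq0 eps0)); rewrite mulVf ?lt0r_neq0 //.
  by rewrite mulrAC -[_ * _ * eps]mulrA epsE mulVf // expf_neq0 // lt0r_neq0.
have e4 : (4 * n + 2)%:R <= 3 * b by rewrite /b -[3]/(3%:R) -natrM ler_nat; lia.
have em : m%:R <= b ^+ 2 by rewrite /b -natrX ler_nat -mul2n.
have eJ : (Num.truncn (2 * m%:R / eps)).+1%:R <= 20 * phi * b ^+ (4 * A + 3) :> R.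
  have bA : 1 <= b ^+ (4 * A) by exact: exprn_ege1.
  have bA3 : 1 <= b ^+ (4 * A + 3) by exact: exprn_ege1.
  have t1 : (Num.truncn (2 * m%:R / eps))%:R <= 2 * m%:R / eps :> R.
    by rewrite truncn_le divr_ge0 ?mulr_ge0 // ltW.
  have t2 : 2 * m%:R / eps <= 18 * phi * b ^+ (4 * A + 3).
    rewrite ie; have -> : 18 * phi * b ^+ (4 * A + 3) =
        2 * b ^+ 2 * (3 * phi * (3 * b) * b ^+ (4 * A)) by rewrite exprD; ring.
    apply: ler_pM; rewrite ?mulr_ge0 ?exprn_ge0 ?(ltW phi0) ?(ltW b0) //.
      by rewrite ler_wpM2l.
    rewrite ler_wpM2r ?exprn_ge0 ?(ltW b0) // ler_wpM2l // mulr_ge0 // ltW //.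
  have t3 : 2 * phi <= 2 * phi * b ^+ (4 * A + 3) by rewrite ler_peMr // mulr_ge0 // ltW.
  rewrite -natr1; lra.
have e2 : (2 ^ h)%:R <= b ^+ h by rewrite natrX lerXn2r ?nnegrE // ltW.
have e20 : 20 <= b ^+ 5.
  apply: (@le_trans _ _ (2 ^+ 5)); first by rewrite -natrX ler_nat.
  by rewrite lerXn2r ?nnegrE // ltW.
rewrite natrM; apply: (@le_trans _ _ (b ^+ h * (b ^+ 5 * phi * b ^+ (4 * A + 3)))).
  apply: ler_pM => //; apply: le_trans eJ _.
  by rewrite ler_wpM2r ?exprn_ge0 ?(ltW b0) // ler_wpM2r // ltW.
have -> : b ^+ h * (b ^+ 5 * phi * b ^+ (4 * A + 3)) = phi * b ^+ (4 * A + 8 + h).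
  by rewrite !exprD; ring.
rewrite ler_pM2l // exprM lerXn2r ?nnegrE ?exprn_ge0 ?(ltW b0) //.
by rewrite /b -natrX ler_nat -mul2n -mulnn leq_mul2r n2 orbT.
Qed.

(** The exponent is quadratic in [L]; the tenth power follows from [1 <= L]. *)
Lemma exponent_le (R : realType) (N Q h : nat) (c L : R) :
  (N <= Q * h ^ 2)%N -> h%:R <= c * L -> 1 <= L -> N%:R <= Q%:R * c ^+ 2 * L ^+ 10.
Proof.
move=> NQ hL L1; apply: (@le_trans _ _ (Q%:R * h%:R ^+ 2)).
  by rewrite -natrX -natrM ler_nat.
rewrite -mulrA; apply: ler_wpM2l => //; apply: (@le_trans _ _ ((c * L) ^+ 2)).
  by apply: lerXn2r => //; rewrite nnegrE // (le_trans _ hL).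
by rewrite exprMn ler_wpM2l ?sqr_ge0 // ler_weXn2l.
Qed.

Theorem theorem1p1 (R : realType) :
  exists (C : R) (eps : nat -> R),
    eps n @[n --> \oo] --> (0 : R) /\
    forall (n : nat) (phi : R) (D : edge n -> probability R R)
      (d : measure_display) (T : measurableType d) (P : probability T R)
      (X : edge n -> {RV P >-> R}),
      0 < phi ->
      (forall e, supported_on_unit (D e)) ->
      (forall e, has_density_le phi (D e)) ->
      mutually_independent X ->
      (forall (e : edge n) (A : set R),
         measurable A -> distribution P (X e) A = D e A) ->
      ((1 - eps n)%:E <=
        P [set omega | every_swap_terminates_within (fun e => X e omega)
                         (phi * n%:R `^ (C * ln n%:R ^+ 10))])%E.
Proof.
(* [r] and [K] are generalized, so that [3 ^ r] is never computed in unary. *)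
have [r r162] : exists r, (162 <= r)%N by exists 162%N.
have [K rK] : exists K, (3 ^ r <= K)%N by exists (3 ^ r)%N.
have [c cK] := exp2_dominates (64 * K).
pose c3 : R := 2 / ln 2 + 2 + c%:R.
(* From [n1] on, [n] is at least 2 and [ln n] at least 1. Below it, [n.+1 <= n1 <= Ce] makes the
   claimed lower bound at most 0. *)
pose n1 := maxn 2 (Num.truncn (expR 1 : R)).+1.
pose Ce : R := (c + 3)%:R + n1%:R.
(* The exponent is [2 * (4 * A + 8 + h)], where [4 * A = 1024 * K * h ^ 2] and
   [8 + h <= 9 * h ^ 2]. *)
have [Q QE] : exists Q, Q = (2 * (1024 * K + 9))%N by eexists.
exists (Q%:R * c3 ^+ 2), (fun n => Ce * n.+1%:R^-1); split.
  rewrite -[X in _ --> X](mulr0 Ce); apply: cvgM; first exact: cvg_cst.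
  exact: cvg_harmonic.
move=> n phi D d T P X phi0 Dsupp Dphi indep distr.
set S := [set omega | _].
have mS : measurable S by exact: measurable_terminates.
have [nn1|nn1] := ltnP n n1.
  apply: (@le_trans _ _ 0%E); last exact: measure_ge0.
  rewrite lee_fin subr_le0 ler_pdivlMr ?ltr0n // mul1r.
  apply: (@le_trans _ _ n1%:R); first by rewrite ler_nat.
  by rewrite /Ce lerDr.
have n2 : (1 < n)%N by apply: leq_trans nn1; rewrite leq_max.
have n0 : (0 < n)%N by apply: ltnW.
have ln1 : 1 <= ln n%:R :> R.
  rewrite -[leLHS]expRK ler_ln ?posrE ?expR_gt0 ?ltr0n //.
  apply/ltW/(lt_le_trans (real_truncnS_gt (num_real _))).
  by rewrite ler_nat; apply: leq_trans nn1; rewrite leq_max leqnn orbT.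
pose h := run_scale c n; pose A := (256 * K * h ^ 2)%N.
have h0 : (0 < h)%N by rewrite /h /run_scale; lia.
pose b : R := n.*2%:R.
have b1 : 1 <= b by rewrite /b -[1]/(1%:R) ler_nat; lia.
pose eps : R := (b ^+ (4 * A))^-1 / (3 * phi * (4 * n + 2)%:R).
have epsE : 3 * phi * ((4 * n + 2)%:R * eps) = (b ^+ (4 * A))^-1.
  have nz : 0 < 3 * phi * (4 * n + 2)%:R.
    by apply: mulr_gt0; [exact: mulr_gt0|rewrite ltr0n addn2].
  by rewrite mulrA /eps mulrC divfK // lt0r_neq0.
have eps0 := eps_gt0 n0 phi0 epsE.
have phi1 : 1 <= 2 * phi.
  have lt0 : (0 < n.*2)%N by lia.
  have lt1 : (1 < n.*2)%N by lia.
  have c2 : #|[set Ordinal lt0; Ordinal lt1]%SET| == 2%N by rewrite cards2.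
  pose e0 : edge n := exist (fun e : {set 'I_n.*2} => #|e| == 2%N) _ c2.
  exact: density_ge_half phi0 (Dphi e0) (Dsupp e0).
have [B [mB PB HB]] := bad_event n0 phi0 Dsupp Dphi indep distr h epsE.
(* Outside these two events the deterministic argument applies for every initial partition and every
   rule at once. *)
have sub : ~` S `<=` ~` (in_range X) `|` B.
  move=> w nS; have [wX|] := pselect (in_range X w); last by left.
  right; apply: contrapT => nB; apply: nS.
  have w1 e : -1 <= X e w <= 1 by have := wX e I; rewrite /= in_itv.
  pose J := (Num.truncn (2 * #|{: edge n}|%:R / eps)).+1.
  have HJ : 2 * #|{: edge n}|%:R < J%:R * eps.
    by rewrite -ltr_pdivrMr // real_truncnS_gt // num_real.
  have st := swap_terminates r162 rK h0 (run_scale_big n0 cK) w1 eps0 (HB w w1 nB) HJ.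
  move=> p0 rule bp0 impl; have [k [kJ kN]] := st p0 rule bp0 impl.
  exists k; split => //; apply: le_trans kJ _.
  apply: le_trans (step_bound h n2 phi1 eps0 (@card_edge n) epsE) _.
  rewrite ler_pM2l // -powR_mulrn // ler_powR ?ler1n //.
  have hln : h%:R <= c3 * ln n%:R := run_scale_ln c n0 ln1.
  apply: exponent_le hln ln1; rewrite QE /A.
  have : (h <= h ^ 2)%N by rewrite -mulnn leq_pmulr.
  have : (0 < h ^ 2)%N by rewrite expn_gt0 h0.
  by set q := (h ^ 2)%N; lia.
have PS : (P (~` S) <= (h.+1%:R / b ^+ 2)%:E)%E.
  have mI : measurable (~` (in_range X)) by exact/measurableC/in_range_measurable.
  apply: (@le_trans _ _ (P (~` (in_range X) `|` B))).
    by apply: le_measure; rewrite ?inE //; [exact: measurableC|exact: measurableU].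
  apply: (le_trans (measureU2 _ mI mB)).
  rewrite -[leRHS]add0e; apply: leeD => //.
  by rewrite le_eqVlt; apply/orP; left; apply/eqP; exact: in_range_full Dsupp distr.
rewrite -(setCK S) probability_setC; last exact: measurableC.
apply: (@le_trans _ _ (1 - (h.+1%:R / b ^+ 2)%:E)%E); last exact: leeB.
rewrite -EFinB lee_fin lerD2l lerN2.
have b0 : 0 < b by rewrite (lt_le_trans ltr01).
(* From [h <= (c + 2) * n] one gets [(h + 1) * (n + 1) <= (c + 3) * n * (n + 1)], which is at most
   [(c + 3) * (2 * n) ^ 2]. *)
rewrite ler_pdivrMr ?exprn_gt0 // mulrAC ler_pdivlMr ?ltr0n //.
apply: (@le_trans _ _ ((c + 3)%:R * b ^+ 2)); last first.
  by rewrite ler_wpM2r ?sqr_ge0 // /Ce lerDl.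
rewrite /b -natrX -!natrM ler_nat.
have := run_scale_le n0 cK; rewrite -/h => hn.
apply: (@leq_trans ((c + 3) * n * n.+1)); first by rewrite leq_mul2r; apply/orP; right; rewrite mulnDl in hn *; lia.
by rewrite -mulnA leq_mul2l -mul2n; apply/orP; right; nia.
Qed.
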